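(* Let $G$ be a simple, simply-connected linear algebraic group over $\mathbb{C}$. Every extremal ray of the cone $\mathscr{K}(G)_{\mathbb{Q}}$ is generated by a pair $(\lambda,\mu)$ where $\lambda=\varpi_j$ is a fundamental weight and $\mu$ is a vertex of $IP_{\varpi_j}$. Conversely, for every fundamental weight $\varpi_j$ and every vertex $\mu$ of $IP_{\varpi_j}$, the pair $(\varpi_j,\mu)$ generates an extremal ray of $\mathscr{K}(G)_{\mathbb{Q}}$.
   Context: Fix a maximal torus and Borel subgroup $T\subset B\subset G$; let $\alpha_1,\dots,\alpha_r$ be the simple roots, $\alpha_1^\vee,\dots,\alpha_r^\vee$ the simple coroots, $\varpi_1,\dots,\varpi_r$ the fundamental weights, and let $x_1,\dots,x_r\in X_*(T)\otimes\mathbb{Q}$ be the fundamental coweights, $\langle\alpha_i,x_j\rangle=\delta_{ij}$. Let $W$ be the Weyl group. The (rational) Kostka cone $\mathscr{K}(G)_{\mathbb{Q}}\subset (X^*(T)\otimes\mathbb{Q})^2$ is the rational cone generated by the pairs $(\lambda,\mu)$ of dominant integral weights such that the $\mu$-weight space of the irreducible representation $V_\lambda$ of highest weight $\lambda$ is nonzero; equivalently it is the set of pairs $(\lambda,\mu)$ with $\langle\lambda-\mu,x_i\rangle\ge 0$, $\langle\lambda,\alpha_i^\vee\rangle\ge 0$, $\langle\mu,\alpha_i^\vee\rangle\ge 0$ for all $i\in\{1,\dots,r\}$. For a dominant weight $\lambda$, the intersection polytope $IP_\lambda$ is the intersection of the Weyl polytope $\mathrm{conv}(W\cdot\lambda)\subset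 X^*(T)\otimes\mathbb{Q}$ with the rational dominant cone $\{\mu : \langle\mu,\alpha_i^\vee\rangle\ge 0\ \forall i\}$; equivalently $IP_\lambda=\{\mu : (\lambda,\mu)\in\mathscr{K}(G)_{\mathbb{Q}}\}$. *)

(* Defs.v *)
From HB Require Import structures.
From mathcomp Require Import all_boot all_order all_algebra.
From mathcomp Require Import boolp classical_sets reals.
From mathcomp Require Import complex.

Set Implicit Arguments.
Unset Strict Implicit.
Unset Printing Implicit Defensive.

Import Order.TTheory GRing.Theory Num.Theory.

Local Open Scope classical_set_scope.
Local Open Scope ring_scope.

(* A triple (G, T, B), with G simple and simply connected over the complex    *)
(* numbers, is encoded, as in Chevalley's classification, by the root datum   *)
(* of (G, T) (reduced, irreducible, with X_*(T) spanned by the coroots) and   *)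
(* the base of the root system defined by B.  Choosing dual bases of X^*(T)   *)
(* and X_*(T) identifies both with 'rV[int]_r, r = dim T, and makes the       *)
(* canonical perfect pairing the dot product; X^*(T) (x) Q is 'rV[rat]_r.     *)

(* Used with Z = int on X^*(T), and with Z = rat on X^*(T) (x) Q. *)
Definition pairing (Z : pzRingType) (r : nat) (u : 'rV[Z]_r)
    (x : 'rV[int]_r) : Z := \sum_(k < r) u 0 k * (x 0 k)%:~R.

Definition toQ (r : nat) (u : 'rV[int]_r) : 'rV[rat]_r := map_mx intr u.

Record root_datum (r : nat) := RootDatum {
  roots : seq 'rV[int]_r;
  (* only the values of [coroot] on [roots] are meaningful *)
  coroot : 'rV[int]_r -> 'rV[int]_r;
  coroot_inj : {in roots &, injective coroot};
  pairing_root_coroot : {in roots, forall a, pairing a (coroot a) = 2};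
  reflection_root : {in roots &, forall a b,
    b - pairing b (coroot a) *: a \in roots};
  reflection_coroot : {in roots &, forall a b,
    coroot b - pairing a (coroot b) *: coroot a \in map coroot roots};
  roots_reduced : {in roots, forall a, a *+ 2 \notin roots}
}.

Section RootDatum.
Variables (r : nat) (D : root_datum r).

Definition irreducible_datum : Prop :=
  roots D != [::] /\
  forall P : pred 'rV[int]_r,
    {in roots D &, forall a b, P a -> ~~ P b -> pairing a (coroot D b) = 0} ->
    {in roots D, forall a, P a} \/ {in roots D, forall a, ~~ P a}.

(* This contains semisimplicity: the coroots have full rank r. *)
Definition simply_connected : Prop :=
  forall x : 'rV[int]_r, exists c : 'rV[int]_r -> int,
    x = \sum_(a <- roots D) c a *: coroot D a.

Definition is_base (alpha : 'I_r -> 'rV[int]_r) : Prop :=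
  [/\ forall i, alpha i \in roots D,
      row_free (\matrix_i toQ (alpha i)) &
      {in roots D, forall b, exists c : 'I_r -> nat,
         b = \sum_i alpha i *+ c i \/ b = - \sum_i alpha i *+ c i}].

Definition reflection (a : 'rV[int]_r) (v : 'rV[rat]_r) : 'rV[rat]_r :=
  v - pairing v (coroot D a) *: toQ a.

Inductive weyl_group : set ('rV[rat]_r -> 'rV[rat]_r) :=
| weyl_id : weyl_group id
| weyl_refl a w :
    a \in roots D -> weyl_group w -> weyl_group (reflection a \o w).

Variable alpha : 'I_r -> 'rV[int]_r.

Definition dominant_cone : set 'rV[rat]_r :=
  [set v | forall i, 0 <= pairing v (coroot D (alpha i))].

Section Representations.
Variables (C : fieldType) (V : vectType C).

Definition lie (f g : 'End(V)) : 'End(V) := ((f \o g) - (g \o f))%VF.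

(* Since G is simply connected, its rational representations are the finite   *)
(* dimensional representations of its Lie algebra, i.e. of the Lie algebra    *)
(* given by Serre's presentation, where h_i = alpha_i^\vee.                   *)
Definition is_representation (e f h : 'I_r -> 'End(V)) : Prop :=
  let A i j : int := pairing (alpha j) (coroot D (alpha i)) in
  [/\ forall i j, lie (h i) (h j) = 0,
      forall i j, lie (e i) (f j) = if i == j then h i else 0,
      forall i j, lie (h i) (e j) = (A i j)%:~R *: e j /\
                  lie (h i) (f j) = - (A i j)%:~R *: f j &
      forall i j, i != j ->
        iter `|1 - A i j|%N (lie (e i)) (e j) = 0 /\
        iter `|1 - A i j|%N (lie (f i)) (f j) = 0].

Definition irreducible_rep (e f h : 'I_r -> 'End(V)) : Prop :=
  (fullv : {vspace V}) != 0%VS /\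
  forall U : {vspace V},
    (forall i, [/\ (e i @: U <= U)%VS, (f i @: U <= U)%VS &
                   (h i @: U <= U)%VS]) ->
    U = 0%VS \/ U = fullv.

(* The coroots alpha_i^\vee span X_*(T), so the h_i determine T-weights. *)
Definition in_weight_space (h : 'I_r -> 'End(V)) (mu : 'rV[int]_r) (v : V) :=
  forall i, h i v = (pairing mu (coroot D (alpha i)))%:~R *: v.

Definition is_highest_weight (e h : 'I_r -> 'End(V)) (lam : 'rV[int]_r) :=
  exists v : V, [/\ v != 0, forall i, e i v = 0 & in_weight_space h lam v].

End Representations.

(* The mu-weight space of V_lambda is nonzero.  As V_lambda is unique up to   *)
(* isomorphism, it is enough to say so for some realization of it.            *)
Definition weight_of_irrep (C : fieldType) (lam mu : 'rV[int]_r) : Prop :=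
  exists (V : vectType C) (e f h : 'I_r -> 'End(V)),
    [/\ is_representation e f h, irreducible_rep e f h,
        is_highest_weight e h lam &
        exists2 v : V, v != 0 & in_weight_space h mu v].

End RootDatum.

Section Convexity.
Variable V : lmodType rat.

Definition cone_generated (S : set V) : set V :=
  [set v | exists (n : nat) (c : 'I_n -> rat) (p : 'I_n -> V),
     [/\ forall i, 0 <= c i, forall i, S (p i) & v = \sum_i c i *: p i]].

Definition conv_hull (S : set V) : set V :=
  [set v | exists (n : nat) (c : 'I_n -> rat) (p : 'I_n -> V),
     [/\ forall i, 0 <= c i, \sum_i c i = 1, forall i, S (p i) &
         v = \sum_i c i *: p i]].

Definition vertex (P : set V) (x : V) : Prop :=
  P x /\ forall (y z : V) (t : rat), P y -> P z -> 0 < t < 1 ->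
    x = t *: y + (1 - t) *: z -> y = x /\ z = x.

Definition ray (v : V) : set V := [set t *: v | t in [set t : rat | 0 <= t]].

Definition extremal_ray (K R : set V) : Prop :=
  [/\ exists2 v, v != 0 & R = ray v,
      R `<=` K &
      forall x y, K x -> K y -> R (x + y) -> R x /\ R y].

End Convexity.

Definition kostka_cone (C : fieldType) (r : nat) (D : root_datum r)
    (alpha : 'I_r -> 'rV[int]_r) : set ('rV[rat]_r * 'rV[rat]_r)%type :=
  cone_generated
    [set p | exists lam mu : 'rV[int]_r,
       [/\ p = (toQ lam, toQ mu), dominant_cone D alpha (toQ lam),
           dominant_cone D alpha (toQ mu) & weight_of_irrep D alpha C lam mu]].

Definition weyl_polytope (r : nat) (D : root_datum r) (lam : 'rV[rat]_r) :
    set 'rV[rat]_r :=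
  conv_hull [set w lam | w in weyl_group D].

Definition intersection_polytope (r : nat) (D : root_datum r)
    (alpha : 'I_r -> 'rV[int]_r) (lam : 'rV[rat]_r) : set 'rV[rat]_r :=
  weyl_polytope D lam `&` dominant_cone D alpha.

Definition fundamental_weights (r : nat) (D : root_datum r)
    (alpha : 'I_r -> 'rV[int]_r) (varpi : 'I_r -> 'rV[rat]_r) : Prop :=
  forall i j, pairing (varpi i) (coroot D (alpha j)) = (i == j)%:R.

(* Main.v *)
(* Write mu <= lambda when lambda - mu is a nonnegative rational combination of
   simple roots.  The Kostka cone is { (lambda, mu) dominant : mu <= lambda } and
   IP_lambda is its slice over lambda, so the theorem becomes polyhedral.

   Cone: weights of an irreducible representation lie below its highest weight
   because it is spanned by the f-words applied to a highest weight vector.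
   Conversely, V_lambda is constructed inside the module coinduced from the
   e_i, realized on functions of words: there, an operator commuting with all
   e_i and vanishing at the empty word is zero, which yields the Serre
   relations and the integrability of the submodule L generated by the highest
   weight vector.  Its weights are then stable under simple reflections, hence
   bounded in an invariant norm, and L is finite dimensional.  A dominant
   mu <= lambda with lambda - mu in the root lattice is reached from lambda by
   subtracting simple roots that pair positively with the current weight, each
   step staying in the weights of L, or in conv(W lambda).

   Extremal rays: if (lambda, mu) lies in the cone and <lambda, alpha_j^vee> > 0,
   one can move lambda along varpi_j and adapt mu, by inverting a principal
   submatrix of the Cartan matrix, so as to preserve all tight inequalities.
   Extremality forces lambda to be proportional to varpi_j. *)
From Pilot Require Import Defs.
From HB Require Import structures.
From mathcomp Require Import all_boot all_order all_algebra.
From mathcomp Require Import boolp classical_sets functions reals.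
From mathcomp Require Import complex.
From mathcomp Require Import ring lra zify.
(* Again, as [roots] also names a constant of fingraph. *)
Import Pilot.Defs.

Set Implicit Arguments.
Unset Strict Implicit.
Unset Printing Implicit Defensive.

Import Order.TTheory GRing.Theory Num.Theory.
Local Open Scope classical_set_scope.
Local Open Scope ring_scope.

(** * Pairings and the Weyl-invariant form *)

Section Pairing.
Variables (Z : pzRingType) (r : nat).
Implicit Types (u v : 'rV[Z]_r) (x y : 'rV[int]_r).

Lemma pairingD u v x : pairing (u + v) x = pairing u x + pairing v x.
Proof.
by rewrite /pairing -big_split; apply: eq_bigr => k _; rewrite !mxE mulrDl.
Qed.

Lemma pairingZ a u x : pairing (a *: u) x = a * pairing u x.
Proof. by rewrite /pairing mulr_sumr; apply: eq_bigr => k _; rewrite !mxE mulrA. Qed.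

Lemma pairingDr u x y : pairing u (x + y) = pairing u x + pairing u y.
Proof.
by rewrite /pairing -big_split; apply: eq_bigr => k _; rewrite !mxE rmorphD mulrDr.
Qed.

Lemma pairingMzr u (n : int) x : pairing u (n *: x) = pairing u x * n%:~R.
Proof.
rewrite /pairing mulr_suml; apply: eq_bigr => k _.
by rewrite !mxE rmorphM -mulrA; congr (_ * _); rewrite -!intrM mulrC.
Qed.

Lemma pairing0 x : pairing 0 x = 0 :> Z.
Proof. by rewrite -(scale0r 0) pairingZ mul0r. Qed.

Lemma pairingB u v x : pairing (u - v) x = pairing u x - pairing v x.
Proof. by rewrite -scaleN1r pairingD pairingZ mulN1r. Qed.

Lemma pairing_sum I s (P : pred I) (F : I -> 'rV[Z]_r) x :
  pairing (\sum_(i <- s | P i) F i) x = \sum_(i <- s | P i) pairing (F i) x.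
Proof.
exact: (big_morph (fun v => pairing v x) (fun u v => pairingD u v x) (pairing0 x)).
Qed.

End Pairing.

Lemma pairing_toQ (r : nat) (u x : 'rV[int]_r) : pairing (toQ u) x = (pairing u x)%:~R.
Proof.
by rewrite /pairing rmorph_sum; apply: eq_bigr => k _; rewrite !mxE rmorphM /= intz.
Qed.

Lemma toQ_is_additive (r : nat) : zmod_morphism (@toQ r).
Proof. by move=> u v; apply/matrixP => i j; rewrite !mxE rmorphB. Qed.

HB.instance Definition _ (r : nat) :=
  GRing.isZmodMorphism.Build 'rV[int]_r 'rV[rat]_r (@toQ r) (@toQ_is_additive r).

Lemma toQZ (r : nat) (n : int) (u : 'rV[int]_r) : toQ (n *: u) = n%:~R *: toQ u.
Proof. by apply/matrixP => i j; rewrite !mxE rmorphM. Qed.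

Lemma toQ_inj (r : nat) : injective (@toQ r).
Proof.
by move=> u v /matrixP E; apply/matrixP => i j; have := E i j; rewrite !mxE => /intr_inj.
Qed.

Section RootSystem.
Variables (r : nat) (D : root_datum r).
Implicit Types (x y v : 'rV[rat]_r) (a b : 'rV[int]_r).

Local Notation "<< v , a >>" := (pairing v (coroot D a)) (format "<< v ,  a >>").

(* The Weyl-invariant inner product, up to scaling on each component. *)
Definition wform x y : rat := \sum_(a <- undup (roots D)) << x, a>> * << y, a>>.

Lemma wformC x y : wform x y = wform y x.
Proof. by apply: eq_bigr => a _; rewrite mulrC. Qed.

Lemma wform_is_linear x : scalar (wform x).
Proof.
move=> c u v; rewrite /wform mulr_sumr -big_split; apply: eq_bigr => a _ /=.
by rewrite pairingD pairingZ; ring.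
Qed.

HB.instance Definition _ x :=
  GRing.isLinear.Build rat 'rV[rat]_r rat *%R (wform x) (wform_is_linear x).

Lemma wformZl c x y : wform (c *: x) y = c * wform x y.
Proof. by rewrite wformC linearZ /= wformC. Qed.

Lemma wformDl x y v : wform (x + y) v = wform x v + wform y v.
Proof. by rewrite wformC linearD /= !(wformC v). Qed.

Lemma wformBl x y v : wform (x - y) v = wform x v - wform y v.
Proof. by rewrite wformC linearB /= !(wformC v). Qed.

Lemma wform_ge0 x : 0 <= wform x x.
Proof. by apply: sumr_ge0 => a _; rewrite -expr2 sqr_ge0. Qed.

Lemma pairing_reflection a b x : a \in roots D -> b \in roots D ->
  << reflection D b x, a>> = << x, a>> - << x, b>> * (pairing b (coroot D a))%:~R.
Proof.
move=> aD bD; rewrite /reflection -scaleNr pairingD pairingZ pairing_toQ mulNr.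
by [].
Qed.

(** The transpose [g] of the reflection is an involution permuting the coroots, so it only reorders
    the sum defining the form. *)
Lemma wform_reflection b x y : b \in roots D ->
  wform (reflection D b x) (reflection D b y) = wform x y.
Proof.
move=> bD; pose g (c : 'rV[int]_r) := c - pairing b c *: coroot D b.
have gK : involutive g.
  move=> c; rewrite /g pairingDr -!scaleNr pairingMzr pairing_root_coroot //.
  rewrite !intz -addrA -scalerDl.
  have -> : - pairing b c + - (pairing b c + 2 * - pairing b c) = 0 by ring.
  by rewrite scale0r addr0.
pose cs := map (coroot D) (undup (roots D)).
have memcs c : (c \in cs) = (c \in map (coroot D) (roots D)).
  by apply/mapP/mapP => -[a aD ->]; exists a; rewrite // mem_undup in aD *.
have ucs : uniq cs.
  rewrite map_inj_in_uniq ?undup_uniq // => a c.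
  by rewrite !mem_undup; apply: coroot_inj.
have pg : perm_eq (map g cs) cs.
  apply: uniq_perm => //; first by rewrite (map_inj_uniq (inv_inj gK)).
  have sub c : c \in cs -> g c \in cs.
    rewrite !memcs => /mapP [a aD ->].
    by rewrite /g; apply: reflection_coroot.
  move=> c; apply/mapP/idP => [[d dD ->]|cD]; first exact: sub.
  by exists (g c); rewrite ?gK ?sub.
have E u v : wform u v = \sum_(c <- cs) pairing u c * pairing v c.
  by rewrite /cs big_map.
rewrite !E -[RHS](perm_big _ pg) /= [RHS]big_map.
have F u c : pairing (reflection D b u) c = pairing u (g c).
  rewrite /reflection /g -!scaleNr pairingD pairingZ pairing_toQ pairingDr pairingMzr.
  by rewrite rmorphN; ring.
by apply: eq_bigr => c _; rewrite !F.
Qed.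

Lemma reflection_root_self b : b \in roots D -> reflection D b (toQ b) = - toQ b.
Proof.
move=> bD; rewrite /reflection pairing_toQ pairing_root_coroot //.
by rewrite scaler_nat mulr2n opprD addrA subrr add0r.
Qed.

(** Invariance under a reflection that negates [b] identifies the coroot of [b] with [2 b / (b, b)]
    through the form. *)
Lemma wform_root b x : b \in roots D ->
  2 * wform x (toQ b) = << x, b>> * wform (toQ b) (toQ b).
Proof.
move=> bD; have := wform_reflection x (toQ b) bD.
rewrite reflection_root_self // linearN /= {1}/reflection wformBl wformZl.
by move=> E; lra.
Qed.

Lemma wform_root_gt0 b : b \in roots D -> 0 < wform (toQ b) (toQ b).
Proof.
move=> bD; rewrite /wform (big_rem b) ?mem_undup //=.
rewrite ltr_pwDl ?pairing_toQ ?pairing_root_coroot //.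
by apply: sumr_ge0 => a _; rewrite -expr2 sqr_ge0.
Qed.

Lemma reflection_wform b x : b \in roots D ->
  reflection D b x =
    x - (2 * wform x (toQ b) / wform (toQ b) (toQ b)) *: toQ b.
Proof.
move=> bD; rewrite wform_root // mulfK //.
by rewrite gt_eqF // wform_root_gt0.
Qed.

Lemma oppr_root b : b \in roots D -> - b \in roots D.
Proof.
move=> bD; have := reflection_root bD bD.
by rewrite pairing_root_coroot // scaler_nat mulr2n opprD addrA subrr add0r.
Qed.

Lemma toQ_reflection a b : 
  toQ (b - pairing b (coroot D a) *: a) = reflection D a (toQ b).
Proof. by rewrite raddfB /= toQZ /reflection pairing_toQ. Qed.

Lemma reflectionK b : b \in roots D -> involutive (reflection D b).
Proof.
move=> bD x; rewrite {1}/reflection pairing_reflection // pairing_root_coroot //.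
rewrite /reflection -addrA -opprD -scalerDl.
have -> : << x, b>> + (<< x, b>> - << x, b>> * 2%:~R) = 0 by ring.
by rewrite scale0r subr0.
Qed.

Lemma reflection_is_linear a : linear (reflection D a).
Proof.
move=> c u v; rewrite /reflection pairingD pairingZ scalerDl -scalerA scalerBr.
by rewrite opprD addrACA.
Qed.

HB.instance Definition _ a :=
  GRing.isLinear.Build rat 'rV[rat]_r 'rV[rat]_r _ (reflection D a) (reflection_is_linear a).

End RootSystem.

(** * Coordinates in a base *)

Section Base.
Variables (r : nat) (D : root_datum r).
Hypothesis scD : simply_connected D.
Variable alpha : 'I_r -> 'rV[int]_r.
Hypothesis baseD : is_base D alpha.
Implicit Types (x y v : 'rV[rat]_r) (i j k : 'I_r).

Local Notation B := (wform D).
Local Notation al i := (toQ (alpha i)).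
Local Notation pr v i := (pairing v (coroot D (alpha i))).
Local Notation cartan i j := (pairing (alpha j) (coroot D (alpha i))).

Lemma simple_root i : alpha i \in roots D.
Proof. by case: baseD. Qed.

Local Hint Resolve simple_root : core.

(** By simple connectedness the coroots span the cocharacters, so a vector of norm zero pairs
    trivially with every cocharacter, coordinate vectors included. *)
Lemma wform_eq0 x : B x x = 0 -> x = 0.
Proof.
move=> /eqP; rewrite psumr_eq0; last by move=> a _; rewrite -expr2 sqr_ge0.
move=> /allP h.
have h0 (y : 'rV[int]_r) : pairing x y = 0.
  have [c ->] := scD y; rewrite big_seq.
  elim/big_rec: _ => [|a z aD IH] /=.
    by rewrite /pairing big1 // => k _; rewrite mxE mulr0.
  rewrite pairingDr pairingMzr IH addr0.
  have /= := h a; rewrite mem_undup => /(_ aD).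
  by rewrite mulf_eq0 orbb => /eqP ->; rewrite mul0r.
apply/matrixP => i k; rewrite ord1 mxE.
have := h0 (delta_mx 0 k); rewrite /pairing (bigD1 k) //= big1 => [|l /negPf lk].
  by rewrite mxE !eqxx mulr1 addr0.
by rewrite mxE lk andbF mulr0.
Qed.

(** For a base, this is the pairing of [v] with the i-th fundamental coweight. *)
Definition coef v i : rat := (v *m invmx (\matrix_k al k)) 0 i.

Lemma coefE v : v = \sum_i coef v i *: al i.
Proof.
have u : (\matrix_k al k) \in unitmx by rewrite -row_free_unit; case: baseD.
rewrite -{1}(mulmxKV u v) mulmx_sum_row; apply: eq_bigr => i _.
by rewrite rowK.
Qed.

Lemma coef_sum (c : 'I_r -> rat) i : coef (\sum_k c k *: al k) i = c i.
Proof.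
have u : (\matrix_k al k) \in unitmx by rewrite -row_free_unit; case: baseD.
rewrite /coef; have -> : \sum_k c k *: al k = (\row_k c k) *m (\matrix_k al k).
  by rewrite mulmx_sum_row; apply: eq_bigr => k _; rewrite rowK mxE.
by rewrite mulmxK // mxE.
Qed.

Lemma coefD u v i : coef (u + v) i = coef u i + coef v i.
Proof. by rewrite /coef mulmxDl mxE. Qed.

Lemma coefZ c v i : coef (c *: v) i = c * coef v i.
Proof. by rewrite /coef -scalemxAl mxE. Qed.

Lemma coef0 i : coef 0 i = 0.
Proof. by rewrite /coef mul0mx mxE. Qed.

Lemma coefN v i : coef (- v) i = - coef v i.
Proof. by rewrite /coef mulNmx mxE. Qed.

Lemma coefB u v i : coef (u - v) i = coef u i - coef v i.
Proof. by rewrite coefD coefN. Qed.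

Lemma coef_simple i j : coef (al i) j = (i == j)%:R.
Proof.
rewrite -[RHS](coef_sum (fun k => (i == k)%:R)) (bigD1 i) //= eqxx scale1r.
by rewrite big1 ?addr0 // => k /negPf ki; rewrite eq_sym ki scale0r.
Qed.

Lemma wform_coef x v : B x v = \sum_i coef v i * B x (al i).
Proof. by rewrite {1}[v]coefE linear_sum; apply: eq_bigr => i _; rewrite linearZ. Qed.

Lemma wform_simple x i : B x (al i) = pr x i * (B (al i) (al i) / 2).
Proof. by have := wform_root x (simple_root i); lra. Qed.

Lemma wform_simple_gt0 i : 0 < B (al i) (al i) / 2.
Proof. by have := wform_root_gt0 (simple_root i); lra. Qed.

Lemma pairing_simple_inj x : (forall i, pr x i = 0) -> x = 0.
Proof.
move=> h; apply: wform_eq0; rewrite {1}wform_coef big1 // => i _.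
by rewrite wform_simple h mul0r mulr0.
Qed.

Definition pos v := forall i, 0 <= coef v i.

(* A nonnegative combination of simple roots making obtuse angles with every
   simple root that it involves has nonpositive norm. *)
Lemma pos_obtuse_eq0 v : pos v -> (forall i, 0 < coef v i -> pr v i <= 0) -> v = 0.
Proof.
move=> v0 h; apply: wform_eq0; apply/eqP; rewrite eq_le wform_ge0 andbT.
rewrite {1}wform_coef; apply: sumr_le0 => i _; rewrite wform_simple.
have := v0 i; rewrite le_eqVlt => /orP [/eqP <-|/[dup] ci /h vi]; first by rewrite mul0r.
by rewrite pmulr_rle0 // pmulr_lle0 ?wform_simple_gt0.
Qed.

(** The difference of the norms is [B (x + y) (x - y)], with [x + y] dominant and [x - y] a
    nonnegative combination of simple roots. *)
Lemma wform_dominant_le x y : dominant_cone D alpha x -> dominant_cone D alpha y ->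
  pos (x - y) -> B y y <= B x x.
Proof.
move=> dx dy p; rewrite -subr_ge0.
have -> : B x x - B y y = B (x + y) (x - y).
  by rewrite wformDl !linearB /= (wformC D y x); ring.
rewrite wform_coef sumr_ge0 // => i _; rewrite mulr_ge0 // wform_simple pairingD.
by rewrite pmulr_lge0 ?wform_simple_gt0 // addr_ge0.
Qed.

Lemma coef_root b : b \in roots D ->
  (forall i, exists n : nat, coef (toQ b) i = n%:R) \/
  (forall i, exists n : nat, coef (toQ b) i = - n%:R).
Proof.
case: baseD => _ _ h /h [c E].
have F : toQ (\sum_i alpha i *+ c i) = \sum_i (c i)%:R *: al i.
  by rewrite raddf_sum; apply: eq_bigr => i _; rewrite raddfMn scaler_nat.
case: E => ->; [left|right] => i; exists (c i).
  by rewrite F coef_sum.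
by rewrite raddfN /= F coefN coef_sum.
Qed.

Lemma coef_reflection i v j :
  coef (reflection D (alpha i) v) j = coef v j - pr v i * (i == j)%:R.
Proof. by rewrite /reflection coefB coefZ coef_simple. Qed.

Lemma cartan_diag i : cartan i i = 2.
Proof. exact: pairing_root_coroot. Qed.

(** Reflecting [alpha j] in [alpha i] gives a root with coordinates 1 on [alpha j] and
    [- cartan i j] on [alpha i]; the coordinates of a root never have opposite signs. *)
Lemma cartan_le0 i j : i != j -> cartan i j <= 0.
Proof.
move=> ij; have jD := reflection_root (simple_root i) (simple_root j).
have cj : coef (reflection D (alpha i) (al j)) j = 1.
  by rewrite coef_reflection coef_simple eqxx (negPf ij) mulr0 subr0.
have ci : coef (reflection D (alpha i) (al j)) i = - (cartan i j)%:~R.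
  by rewrite coef_reflection coef_simple eq_sym (negPf ij) eqxx mulr1 sub0r pairing_toQ.
rewrite -toQ_reflection in ci cj.
case: (coef_root jD) => h.
  by have [n] := h i; rewrite ci => E; have := ler0n rat n; rewrite -E oppr_ge0 lerz0.
by have [n] := h j; rewrite cj => E; have := ler0n rat n; rewrite -oppr_le0 -E ler10.
Qed.

Lemma cartan_eq0 i j : cartan i j = 0 -> cartan j i = 0.
Proof.
move=> h; have /eqP := wformC D (al i) (al j).
rewrite (wform_simple _ j) (wform_simple _ i) !pairing_toQ h mul0r mulf_eq0 intr_eq0.
by rewrite (gt_eqF (wform_simple_gt0 j)) orbF => /eqP.
Qed.

End Base.

(** * Descent from a dominant weight along simple roots *)

Section Descent.
Variables (r : nat) (D : root_datum r).
Hypothesis scD : simply_connected D.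
Variable alpha : 'I_r -> 'rV[int]_r.
Hypothesis baseD : is_base D alpha.
Variable varpi : 'I_r -> 'rV[rat]_r.
Hypothesis varpiE : fundamental_weights D alpha varpi.
Implicit Types (x y v lam : 'rV[rat]_r) (i j : 'I_r) (c k : {ffun 'I_r -> nat}).

Local Notation B := (wform D).
Local Notation al i := (toQ (alpha i)).
Local Notation pr v i := (pairing v (coroot D (alpha i))).
Local Notation s_ i := (reflection D (alpha i)).
Local Notation coef := (coef alpha).
Local Notation pos := (pos alpha).

Definition down lam c := lam - \sum_i (c i)%:R *: al i.

Lemma coef_down lam c i : coef (lam - down lam c) i = (c i)%:R.
Proof. by rewrite /down opprB addrC subrK (coef_sum baseD). Qed.

Definition incr c i : {ffun 'I_r -> nat} := [ffun j => (c j + (i == j))%N].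

Lemma down_incr lam c i : down lam (incr c i) = down lam c - al i.
Proof.
rewrite /down -addrA -opprD; congr (_ - _).
rewrite [RHS]addrC (bigD1 i) //= [in RHS](bigD1 i) //= addrA; congr (_ + _).
  by rewrite ffunE eqxx natrD scalerDl scale1r addrC.
by apply: eq_bigr => j ji; rewrite ffunE eq_sym (negPf ji) addn0.
Qed.

Lemma down0 lam : down lam [ffun=> 0%N] = lam.
Proof.
by rewrite /down big1 ?subr0 // => i _; rewrite ffunE scale0r.
Qed.

(* If descending from [c] towards [k] along simple roots were blocked, then
   [k - c] would be obtuse to its simple roots, hence zero. *)
Lemma dominant_descent (S : {ffun 'I_r -> nat} -> Prop) lam k :
    S [ffun=> 0%N] ->
    (forall c i, S c -> 0 < pr (down lam c) i -> S (incr c i)) ->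
    dominant_cone D alpha (down lam k) ->
  S k.
Proof.
move=> S0 step dom.
(* Induction on the number of simple roots still to be subtracted. *)
suff H n c : S c -> (forall i, c i <= k i)%N -> (\sum_i (k i - c i))%N = n -> S k.
  by apply: (H _ _ S0) => // i; rewrite ffunE.
elim: n c => [|n IH] c Sc ck E.
  suff <- : c = k by [].
  apply/ffunP => i; apply/eqP; rewrite eqn_leq ck /= -subn_eq0.
  by move/eqP: E; rewrite sum_nat_eq0 => /forallP /(_ i).
have cv i : coef (down lam c - down lam k) i = (k i)%:R - (c i)%:R.
  by rewrite -!(coef_down lam) !coefB; ring.
have [i ki pi] : exists2 i, (c i < k i)%N & 0 < pr (down lam c) i.
  apply: contrapT => h.
  have v0 : down lam c - down lam k = 0.
    apply: (pos_obtuse_eq0 scD baseD) => i; rewrite cv; first by rewrite subr_ge0 ler_nat.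
    rewrite subr_gt0 ltr_nat => ci; rewrite pairingB subr_le0.
    apply: le_trans (dom i); rewrite leNgt; apply/negP => pi.
    by apply: h; exists i.
  move: E; rewrite big1 // => i _; apply/eqP; rewrite subn_eq0 -(ler_nat rat).
  by rewrite -subr_le0 -cv v0 coef0.
apply: (IH (incr c i)); first exact: step.
  move=> j; rewrite ffunE; case: eqP => [<-|_]; last by rewrite addn0.
  by rewrite addn1.
apply/eqP; rewrite -eqSS -E (bigD1 i) //= [in X in _ == X](bigD1 i) //= ffunE eqxx.
apply/eqP; rewrite -addSn; congr (_ + _)%N; first by rewrite addn1 subnSK.
by apply: eq_bigr => j ji; rewrite ffunE eq_sym (negPf ji) addn0.
Qed.

(** This rescaled sum of fundamental weights represents the height functional, so that bounds on
    norms become bounds on heights. *)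
Lemma wform_varpi v : B v (\sum_j (2 / B (al j) (al j)) *: varpi j) = \sum_i coef v i.
Proof.
rewrite wformC (wform_coef baseD); apply: eq_bigr => i _.
rewrite (wform_simple baseD) pairing_sum.
rewrite (bigD1 i) //= big1 => [|j /negPf ji].
  rewrite pairingZ varpiE eqxx mulr1 addr0.
  have := wform_simple_gt0 baseD i => h; field.
  by apply/eqP => h0; rewrite h0 mul0r ltxx in h.
by rewrite pairingZ varpiE ji mulr0.
Qed.

(** A substitute for Cauchy-Schwarz without square roots. *)
Lemma wform_ge_neg x y : - (2 * B x y) <= B x x + B y y.
Proof.
by have := wform_ge0 D (x + y); rewrite wformDl !linearD /= (wformC D y x); lra.
Qed.

(** Reflecting a weight in a simple root on which it is negative preserves its norm and brings it
    closer to [lam]. Its norm is thus that of a dominant weight, at most that of [lam], and the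
    height functional bounds [c]. *)
Lemma reflection_stable_bounded (S : {ffun 'I_r -> nat} -> Prop) lam :
    dominant_cone D alpha lam ->
    (forall c i, S c -> exists2 c', S c' & down lam c' = s_ i (down lam c)) ->
  exists N, forall c, S c -> (\sum_i c i <= N)%N.
Proof.
move=> dl refl.
have norm n c : S c -> (\sum_i c i < n)%N -> B (down lam c) (down lam c) <= B lam lam.
  elim: n c => [|n IH] c Sc cn; first by [].
  have [dom|ndom] := pselect (dominant_cone D alpha (down lam c)).
    apply: (wform_dominant_le baseD) => // i.
    by rewrite coef_down.
  have [i pi] : exists i, pr (down lam c) i < 0.
    apply: contrapT => h; apply: ndom => i; rewrite leNgt; apply/negP => pi.
    by apply: h; exists i.
  have [c' Sc' E] := refl c i Sc.
  have aD : alpha i \in roots D by case: baseD.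
  rewrite -(wform_reflection _ _ aD) -E; apply: IH => //.
  (* Only the i-th coordinate changes, and it drops because the pairing is negative. *)
  have cj j : (c' j)%:R = (c j)%:R + pr (down lam c) i * (i == j)%:R.
    have H := coef_down lam c j; have := coef_down lam c' j.
    rewrite E (coefB _ lam (reflection _ _ _)) (coef_reflection baseD) => <-.
    by rewrite -H (coefB _ lam (down lam c)); ring.
  apply: (leq_trans _ (ltnSE cn)).
  rewrite (bigD1 i) //= [X in (_ < X)%N](bigD1 i) //= -addSn leq_add //.
    by rewrite -(ltr_nat rat) cj eqxx mulr1 gtrDl.
  apply: leq_sum => j ji; rewrite -(ler_nat rat) cj eq_sym (negPf ji).
  by rewrite mulr0 addr0.
pose om := \sum_j (2 / B (al j) (al j)) *: varpi j.
(* [M] arises by bounding [- (2 * B (down lam c) om)] with [wform_ge_neg], and the norm of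
   [down lam c] by that of [lam]. *)
pose M : rat := 2 * B lam om + B lam lam + B om om.
exists (Num.bound M) => c Sc; rewrite -(ler_nat rat).
have Ec : (\sum_i c i)%:R = B lam om - B (down lam c) om.
  rewrite -wformBl wform_varpi natr_sum; apply: eq_bigr => i _.
  by rewrite coef_down.
have n1 := norm _ _ Sc (ltnSn _).
have n2 := wform_ge_neg (down lam c) om.
have c0 : 0 <= (\sum_i c i)%:R :> rat := ler0n _ _.
have M0 : 2 * (\sum_i c i)%:R <= M by rewrite Ec /M; lra.
have M1 : 0 <= M by apply: le_trans M0; rewrite mulr_ge0.
by have h := archi_boundP M1; lra.
Qed.

End Descent.

(** * The Weyl group *)

Section WeylGroup.
Variables (r : nat) (D : root_datum r).
Variable alpha : 'I_r -> 'rV[int]_r.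
Hypothesis baseD : is_base D alpha.
Implicit Types (x y v lam : 'rV[rat]_r) (i j : 'I_r) (b : 'rV[int]_r).

Local Notation pr v i := (pairing v (coroot D (alpha i))).
Local Notation s_ i := (reflection D (alpha i)).
Local Notation coef := (coef alpha).
Local Notation pos := (pos alpha).

(** Written through the form, a reflection is homogeneous of degree 0 in its root. *)
Lemma reflection_proportional b b' (m : rat) : b \in roots D -> b' \in roots D ->
  m != 0 -> toQ b = m *: toQ b' -> reflection D b =1 reflection D b'.
Proof.
move=> bD bD' m0 E x; rewrite !reflection_wform // E wformZl !linearZ /= scalerA.
have := wform_root_gt0 bD' => h; congr (x + _ *: - toQ b'); field.
by rewrite m0 gt_eqF.
Qed.

Lemma reflection_conj a b x : a \in roots D -> b \in roots D ->
  reflection D b x = reflection D a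
    (reflection D (b - pairing b (coroot D a) *: a) (reflection D a x)).
Proof.
move=> aD bD; have bD' := reflection_root aD bD.
rewrite [in RHS](reflection_wform _ bD') toQ_reflection !wform_reflection //.
by rewrite linearB /= linearZ /= !(reflectionK aD) reflection_wform.
Qed.

Definition wact (s : seq 'I_r) x := foldr (fun i y => s_ i y) x s.

Lemma wact_cat s t x : wact (s ++ t) x = wact s (wact t x).
Proof. by rewrite /wact foldr_cat. Qed.

(** Otherwise [(b, b)], expanded in simple roots, would be a sum of nonpositive terms. *)
Lemma pos_root_descent b : b \in roots D -> pos (toQ b) ->
  exists2 i, 0 < coef (toQ b) i & 0 < pr (toQ b) i.
Proof.
move=> bD pb; apply: contrapT => h; have := wform_root_gt0 bD; rewrite ltNge => /negP; apply.
rewrite {1}(wform_coef baseD) sumr_le0 // => i _; rewrite (wform_simple baseD).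
have := pb i; rewrite le_eqVlt => /orP [/eqP <-|ci]; first by rewrite mul0r.
rewrite pmulr_rle0 // pmulr_lle0 ?(wform_simple_gt0 baseD) // leNgt.
by apply/negP => pi; apply: h; exists i.
Qed.

(** Induction on a bound [n] for the height: a simple reflection with positive pairing lowers the
    height by at least 1, and conjugating by it recovers the reflection in [b]. *)
Lemma pos_root_reflection n b : b \in roots D -> pos (toQ b) ->
  \sum_i coef (toQ b) i <= n%:R -> exists s, reflection D b =1 wact s.
Proof.
elim: n b => [|n IH] b bD pb sb; have [i ci pi] := pos_root_descent bD pb.
  by move: sb; rewrite leNgt (bigD1 i) //= ltr_pwDl // sumr_ge0.
have iD : alpha i \in roots D by case: baseD.
have bD' := reflection_root iD bD.
have cb' j := coef_reflection baseD i (toQ b) j.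
rewrite -toQ_reflection in cb'.
set b' := b - _ in bD' cb'.
have [p|p] := coef_root baseD bD'.
  have [||s hs] := IH b' bD'; first by move=> j; have [m ->] := p j.
    rewrite (eq_bigr _ (fun j _ => cb' j)) big_split /= sumrN.
    rewrite -mulr_sumr (_ : \sum_j (i == j)%:R = 1) ?mulr1; last first.
      by rewrite (bigD1 i) //= eqxx big1 ?addr0 // => j /negPf; rewrite eq_sym => ->.
    move: pi; rewrite pairing_toQ ltr0z gtz0_ge1 -(ler1z rat).
    by move: sb; rewrite -natr1; lra.
  exists (i :: rcons s i) => x; rewrite (reflection_conj _ iD bD) -/b' hs.
  by rewrite -cats1 /= wact_cat.
(* The reflected root is negative but agrees with [b] away from [i], so [b] is a multiple of
   [alpha i]. *)
exists [:: i] => x; rewrite /=.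
apply: (@reflection_proportional _ _ (coef (toQ b) i)) => //; first by rewrite gt_eqF.
rewrite {1}[toQ b](coefE baseD) (bigD1 i) //= big1 ?addr0 // => j ji.
have [m] := p j; rewrite cb' eq_sym (negPf ji) mulr0 subr0 => E.
suff -> : coef (toQ b) j = 0 by rewrite scale0r.
by apply/eqP; rewrite eq_le pb {1}E oppr_le0 ler0n.
Qed.

Lemma root_reflection_simple b : b \in roots D -> exists s, reflection D b =1 wact s.
Proof.
have posP a : a \in roots D -> pos (toQ a) -> exists s, reflection D a =1 wact s.
  move=> aD pa; apply: (pos_root_reflection (n := Num.bound (\sum_i coef (toQ a) i))) => //.
  by apply/ltW/archi_boundP/sumr_ge0.
move=> bD; have [h|h] := coef_root baseD bD.
  by apply: posP => // i; have [m ->] := h i.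
have [|s hs] := posP _ (oppr_root bD).
  move=> i; have [m E] := h i.
  by rewrite raddfN /= -scaleN1r coefZ E mulN1r opprK.
exists s => x; rewrite -hs.
apply: (@reflection_proportional _ _ (-1)) => //; first exact: oppr_root.
by rewrite raddfN /= scaleN1r opprK.
Qed.

Lemma weyl_groupP w : weyl_group D w -> exists s, w =1 wact s.
Proof.
elim=> [|a u aD _ [s hs]]; first by exists [::].
have [t ht] := root_reflection_simple aD.
by exists (t ++ s) => x; rewrite wact_cat -hs -ht.
Qed.

Lemma weyl_group_linear w : weyl_group D w -> linear w.
Proof. by elim=> [|a u aD _ h] c x y //=; rewrite h linearP. Qed.

End WeylGroup.

(** * Clearing denominators *)

Lemma ex_common_denominator (I : finType) (f : I -> rat) :
  exists2 N : nat, (0 < N)%N & forall i, exists m : int, N%:R * f i = m%:~R.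
Proof.
exists `|(\prod_i denq (f i))%R|%N.
  by rewrite absz_gt0; apply/prodf_neq0 => i _; rewrite denq_neq0.
move=> i; rewrite (bigD1 i) //= abszM natrM.
exists (`|(\prod_(j | j != i) denq (f j))%R|%N%:Z * numq (f i)).
rewrite rmorphM /= mulrAC natr_absz [`|denq _|]gtr0_norm ?denq_gt0 //.
by rewrite [_%:~R * f i]mulrC -numqE mulrC.
Qed.

Lemma rV_common_denominator (r : nat) (v : 'rV[rat]_r) :
  exists2 N : nat, (0 < N)%N & exists u : 'rV[int]_r, N%:R *: v = toQ u.
Proof.
have [N N0 h] := ex_common_denominator (v 0); exists N => //.
exists (\row_i projT1 (cid (h i))); apply/rowP => i.
by rewrite !mxE; case: cid.
Qed.

(** * Modules over the Lie algebra without Serre relations *)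

Section Commutator.
Variables (K : numFieldType) (M : lmodType K).

Definition bracket (f g : M -> M) : M -> M := fun x => f (g x) - g (f x).

Lemma bracket_is_linear (f g : {linear M -> M}) : linear (bracket f g).
Proof.
by move=> c x y; rewrite /bracket (linearP f) !(linearP g) (linearP f) scalerBr opprD addrACA.
Qed.

HB.instance Definition _ (f g : {linear M -> M}) :=
  GRing.isLinear.Build K M M _ (bracket f g) (bracket_is_linear f g).

Fixpoint adn n (f g : {linear M -> M}) : {linear M -> M} :=
  if n is n'.+1 then bracket f (adn n' f g) : {linear M -> M} else g.

Lemma adnS n f g x : adn n.+1 f g x = f (adn n f g x) - adn n f g (f x).
Proof. by []. Qed.

Lemma adnSr n f g x : adn n.+1 f g x = adn n f (bracket f g : {linear M -> M}) x.
Proof.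
by elim: n x => [//|n IH] x; rewrite adnS !IH.
Qed.

(** Moving one [f] past [g] either shortens the string of [x] or replaces [g] by its bracket with
    [f]. This propagates nilpotency of [f] from [x] to [g x]. *)
Lemma iter_ad0 n m f (g : {linear M -> M}) x : (forall y, adn n f g y = 0) ->
  iter m f x = 0 -> iter (m + n) f (g x) = 0.
Proof.
have it0 k : iter k f 0 = 0 by elim: k => //= k ->; rewrite linear0.
elim: n g m x => [|n IH] g m x; first by move=> /= -> _; rewrite it0.
move=> h; have h' y : adn n f (bracket f g : {linear M -> M}) y = 0.
  by rewrite -adnSr h.
elim: m x => [|m IHm] x.
  by move=> /= ->; rewrite linear0 it0 linear0.
rewrite iterSr => fx; rewrite addSn iterSr.
have -> : f (g x) = g (f x) + bracket f g x by rewrite /bracket addrC subrK.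
have lin k y z : iter k f (y + z) = iter k f y + iter k f z.
  by elim: k => //= k ->; rewrite linearD.
rewrite lin IHm // add0r addnS -addSn; apply: IH => //.
by rewrite iterSr.
Qed.

(* If [g] is a highest weight vector of weight [-a] for the adjoint action of
   an sl2-triple (e, f, h), this is the usual formula for [e f^n g]. *)
Lemma bracket_adn (a : K) (e f h g : {linear M -> M}) :
  (forall x, e (f x) = f (e x) + h x) ->
  (forall x, h (f x) = f (h x) - 2 *: f x) ->
  (forall x, e (g x) = g (e x)) ->
  (forall x, h (g x) = g (h x) - a *: g x) ->
  forall n x, 
   h (adn n f g x) = adn n f g (h x) - (a + n%:R * 2) *: adn n f g x /\
   e (adn n.+1 f g x) =
    adn n.+1 f g (e x) - (n.+1%:R * (a + n%:R)) *: adn n f g x.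
Proof.
move=> ef hf eg hg.
have sub2 s t (A P : M) : A - s *: P - t *: P = A - (s + t) *: P.
  by rewrite -addrA -opprD -scalerDl.
have subZ s (A P C Q : M) : (A - s *: P) - (C - s *: Q) = (A - C) - s *: (P - Q).
  by rewrite scalerBr !opprB [s *: Q - C]addrC addrACA [- (s *: P) + _]addrC.
have shift (X B w Y : M) : X + (B - w) - (B + Y) = X - Y - w.
  by rewrite opprD [X + _]addrCA addrACA subrr add0r addrAC.
have hn n x : h (adn n f g x) = adn n f g (h x) - (a + n%:R * 2) *: adn n f g x.
  elim: n x => [|n IH] x; first by rewrite mul0r addr0 hg.
  rewrite !adnS linearB /= hf !IH hf (linearB f) (linearB (adn n f g)) /=.
  rewrite (linearZ_LR f) (linearZ_LR (adn n f g)) /=.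
  by rewrite !sub2 [2 + _]addrC subZ -[n.+1%:R]natr1 mulrDl mul1r !addrA.
have en n x : e (adn n.+1 f g x) =
    adn n.+1 f g (e x) - (n.+1%:R * (a + n%:R)) *: adn n f g x.
  elim: n x => [|n IH] x.
    rewrite mul1r addr0 !adnS (linearB e) ef !eg hg ef (linearD g).
    by rewrite [g (f (e x)) + _]addrC shift.
  rewrite adnS (linearB e) ef !IH hn ef (linearD (adn n.+1 f g)) (linearB f) (linearZ_LR f).
  rewrite [X in _ - (X - _)]addrC -[X in _ - X]addrA shift subZ.
  rewrite -addrA -opprD -adnS -scalerDl -adnS; congr (_ - _ *: _).
  by rewrite -[n.+2%:R]natr1 -[n.+1%:R]natr1; ring.
by [].
Qed.

End Commutator.

(** * Strings in sl2-modules *)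

Section SL2.
Variables (K : numFieldType) (M : lmodType K).
Variables e f h : {linear M -> M}.
Hypothesis ef : forall x, e (f x) = f (e x) + h x.
Hypothesis hf : forall x, h (f x) = f (h x) - 2 *: f x.

Lemma sl2_string m y s : e y = 0 -> h y = m *: y ->
  h (iter s f y) = (m - s%:R * 2) *: iter s f y /\
  e (iter s.+1 f y) = (s.+1%:R * (m - s%:R)) *: iter s f y.
Proof.
move=> ey hy.
have hs t : h (iter t f y) = (m - t%:R * 2) *: iter t f y.
  elim: t => [|t IH]; first by rewrite mul0r subr0.
  rewrite iterS hf IH linearZ /= -scalerBl; congr (_ *: _).
  by rewrite -[t.+1%:R]natr1; ring.
split=> //; elim: s => [|s IH]; first by rewrite /= ef ey linear0 add0r hy subr0 mul1r.
rewrite iterS ef IH hs linearZ /= -scalerDl; congr (_ *: _).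
by rewrite -[s.+2%:R]natr1 -[s.+1%:R]natr1; ring.
Qed.

(** Since [e] maps [f^(s+1) y] to [(s + 1) (m - s) f^s y], the string can only break right after
    step [m], with [m] a natural number. *)
Lemma sl2_string_neq0 m y s : e y = 0 -> h y = m *: y -> y != 0 ->
  (forall t, (t < s)%N -> m != t%:R) -> iter s f y != 0.
Proof.
move=> ey hy y0; elim: s => [//|s IH] ms; apply/eqP => E.
have := (sl2_string s ey hy).2; rewrite E linear0 => /esym /eqP.
rewrite scaler_eq0 mulf_eq0 pnatr_eq0 subr_eq0 (negPf (ms s _)) //=.
by apply/negP/IH => t ts; apply: ms; rewrite ltnS ltnW.
Qed.
End SL2.

Section GModule.
Variables (K : numFieldType) (M : lmodType K) (r : nat).

(* Modules over Serre's presentation without the Serre relations. *)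
Record gmodule (A : 'I_r -> 'I_r -> int) (E F H : 'I_r -> {linear M -> M}) : Prop := GModule {
  gmodHH : forall i j x, H i (H j x) = H j (H i x);
  gmodEF : forall i j x, E i (F j x) = F j (E i x) + (if i == j then H i x else 0);
  gmodHE : forall i j x, H i (E j x) = E j (H i x) + (A i j)%:~R *: E j x;
  gmodHF : forall i j x, H i (F j x) = F j (H i x) - (A i j)%:~R *: F j x }.

Definition neg_lin (f : {linear M -> M}) : {linear M -> M} := \- f.

Variables (A : 'I_r -> 'I_r -> int) (E F H : 'I_r -> {linear M -> M}).
Hypothesis G : gmodule A E F H.
Hypothesis Adiag : forall i, A i i = 2.
Hypothesis Ale0 : forall i j, i != j -> A i j <= 0.
Hypothesis A0sym : forall i j, A i j = 0 -> A j i = 0.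

(** The Chevalley involution, which transfers statements about [F] to [E]. *)
Lemma gmodule_opp : gmodule A F E (fun i => neg_lin (H i)).
Proof.
case: G => HH EF HE HF; split=> i j x; rewrite /neg_lin /=.
- by rewrite !linearN /= !opprK HH.
- rewrite EF eq_sym -addrA; case: eqP => [->|_]; first by rewrite subrr addr0.
  by rewrite !addr0.
- by rewrite HF linearN opprB addrC.
- by rewrite HE linearN opprD.
Qed.

Lemma gmod_sl2 i : (forall x, E i (F i x) = F i (E i x) + H i x) /\
  (forall x, H i (F i x) = F i (H i x) - 2 *: F i x).
Proof. by split=> x; rewrite ?(gmodEF G) ?(gmodHF G) ?eqxx ?Adiag. Qed.

(** For [k = i], the coefficient in [bracket_adn] vanishes exactly at [n = - A i j]. For [k]
    different from [i] and [j], [E k] commutes with both operators. For [k = j], the bracket with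
    [E j] turns [F j] into [H j]. *)
Lemma gmod_serre i j k x : i != j ->
  E k (adn `|1 - A i j|%N (F i) (F j) x) = adn `|1 - A i j|%N (F i) (F j) (E k x).
Proof.
move=> ij; have Ef l m : l != m -> forall y, E l (F m y) = F m (E l y).
  by move=> /negPf lm y; rewrite (gmodEF G) lm addr0.
have [n nE] : exists n : nat, A i j = - n%:Z.
  by exists `|A i j|%N; rewrite lez0_abs ?Ale0 // opprK.
have -> : `|1 - A i j|%N = n.+1 by rewrite nE opprK.
have [<-|ki] := eqVneq i k.
  have [ef hf] := gmod_sl2 i.
  have hg y : H i (F j y) = F j (H i y) - (A i j)%:~R *: F j y by rewrite (gmodHF G).
  have [_ ->] := bracket_adn ef hf (Ef _ _ ij) hg n x.
  by rewrite nE rmorphN /= addNr mulr0 scale0r subr0.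
rewrite eq_sym in ki.
have [kj|kj] := eqVneq k j; last first.
  by elim: n.+1 x => [|m IH] x; rewrite ?adnS ?(linearB (E k)) ?Ef ?IH ?Ef.
have cE m y : E k (adn m (F i) (F j) y) = adn m (F i) (F j) (E k y) + adn m (F i) (H j) y.
  elim: m y => [|m IH] y; first by rewrite (gmodEF G) kj eqxx.
  rewrite !adnS (linearB (E k)) Ef // !IH Ef // (linearD (F i)) opprD.
  by rewrite addrACA.
rewrite cE; suff -> : adn n.+1 (F i) (H j) x = 0 by rewrite addr0.
have c1 y : bracket (F i) (H j) y = (A j i)%:~R *: F i y.
  by rewrite /bracket (gmodHF G) opprB addrC subrK.
(* The bracket of [F i] with [H j] is [A j i] times [F i], so a second bracket kills it. Only one
   bracket is available when [A i j = 0], and then [A j i = 0] too. *)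
case: n nE {cE} => [|n] nE; first by rewrite [LHS]c1 A0sym ?scale0r // nE.
have c2 m y : adn m.+2 (F i) (H j) y = 0.
  elim: m y => [|m IH] y; first by rewrite adnS /= !c1 linearZ subrr.
  by rewrite adnS !IH linear0 subr0.
exact: c2.
Qed.

End GModule.

(** * A coinduced module and its simple submodule *)

Section CoinducedModule.
Variables (K : numFieldType) (r : nat).
Variables (A : 'I_r -> 'I_r -> int) (lam : 'I_r -> int).
Local Notation M := (seq 'I_r -> K^o).
Implicit Types (phi psi : M) (i j k : 'I_r) (x y w : seq 'I_r).

(** The value on the i-th coroot of [lam] minus the simple roots read along [x]. *)
Definition word_wt i x : int := lam i - \sum_(k <- x) A i k.

Lemma word_wt_cons i k x : word_wt i (k :: x) = word_wt i x - A i k.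
Proof. by rewrite /word_wt big_cons opprD addrA addrAC. Qed.

Definition Hfun i phi : M := fun x => (word_wt i x)%:~R * phi x.
Definition Efun i phi : M := fun x => phi (i :: x).
(** Forced by the commutation of [E i] with [F j]: the value at [i :: y] is that of [E i (F j phi)]
    at [y]. The value at the empty word is set to 0. *)
Fixpoint Ffun j phi x : K^o :=
  if x is i :: y then Ffun j (Efun i phi) y + (if i == j then Hfun i phi y else 0)
  else 0.

Lemma fctD phi psi x : (phi + psi) x = phi x + psi x :> K.
Proof. by []. Qed.

Lemma fctZ c phi x : (c *: phi) x = c * phi x :> K.
Proof. by []. Qed.

Lemma fctB phi psi x : (phi - psi) x = phi x - psi x :> K.
Proof. by []. Qed.

Lemma Hfun_is_linear i : linear (Hfun i).
Proof.
move=> c phi psi; apply/funext => x.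
by rewrite fctD fctZ /Hfun !fctD fctZ mulrDr mulrCA.
Qed.

Lemma Efun_is_linear i : linear (Efun i).
Proof. by []. Qed.

Lemma Ffun_is_linear j : linear (Ffun j).
Proof.
move=> c phi psi; apply/funext => x; elim: x phi psi => [|i x IH] phi psi /=.
  by rewrite fctD fctZ /= mulr0 addr0.
rewrite Efun_is_linear IH Hfun_is_linear !fctD !fctZ /=.
by case: eqP => _; rewrite ?addr0 // mulrDr addrACA.
Qed.

HB.instance Definition _ i := GRing.isLinear.Build K M M _ (Hfun i) (Hfun_is_linear i).
HB.instance Definition _ i := GRing.isLinear.Build K M M _ (Efun i) (Efun_is_linear i).
HB.instance Definition _ i := GRing.isLinear.Build K M M _ (Ffun i) (Ffun_is_linear i).

Definition Eop i : {linear M -> M} := Efun i.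
Definition Fop i : {linear M -> M} := Ffun i.
Definition Hop i : {linear M -> M} := Hfun i.

Lemma Hop_Eop i j phi : Hop i (Eop j phi) = Eop j (Hop i phi) + (A i j)%:~R *: Eop j phi.
Proof.
apply/funext => x; rewrite fctD fctZ /= /Hfun /Efun word_wt_cons.
by rewrite -mulrDl -rmorphD /= subrK.
Qed.

(** The relation between [E] and [F] is built into [Ffun]; the one between [H] and [F] follows by
    induction on the word of evaluation, for all [phi] at once. *)
Lemma coinduced_gmodule : gmodule A Eop Fop Hop.
Proof.
split=> i j phi.
- by apply/funext => x; rewrite /= /Hfun mulrCA.
- by apply/funext => x; rewrite fctD /= {1}/Efun /=; case: eqP => [->|].
- exact: Hop_Eop.
- apply/funext => x; rewrite fctB fctZ.
  elim: x phi => [|k x IH] phi; first by rewrite /= /Hfun !mulr0 subr0.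
  have := IH (Eop k phi); rewrite Hop_Eop linearD linearZ /= fctD fctZ /Hfun.
  rewrite -/(Efun k phi) word_wt_cons intrB.
  rewrite -[Ffun j phi (k :: x)]/(Ffun j (Efun k phi) x +
     (if k == j then Hfun k phi x else 0)) /Hfun.
  move: (Ffun j (Efun k phi) x : K) => u.
  move: (Ffun j (Efun k _) x : K) => v h.
  have {h} -> : v = (word_wt i x)%:~R * u - (A i k)%:~R * u + (A i j)%:~R * u :> K.
    by rewrite h; ring.
  by case: eqP => [->|_]; ring.
Qed.

End CoinducedModule.

(** * The submodule generated by the highest weight vector: integrability and weights *)

Section IrreducibleModule.
Variables (K : numFieldType) (r : nat).
Variables (A : 'I_r -> 'I_r -> int) (lam : 'I_r -> int).
Hypothesis Adiag : forall i, A i i = 2.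
Hypothesis Ale0 : forall i j, i != j -> A i j <= 0.
Hypothesis A0sym : forall i j, A i j = 0 -> A j i = 0.
Hypothesis lam_ge0 : forall i, 0 <= lam i.

Local Notation M := (seq 'I_r -> K^o).
Implicit Types (phi psi : M) (i j k : 'I_r) (x y w : seq 'I_r)
  (c : {ffun 'I_r -> nat}).
Local Notation E := (@Eop K r).
Local Notation F := (@Fop K r A lam).
Local Notation H := (@Hop K r A lam).
Local Notation wt := (word_wt A lam).

Let G : gmodule A E F H := coinduced_gmodule K A lam.

(** Values at nonempty words are values of some [E k phi]. Hence vectors killed by all [E k] are
    multiples of the indicator of the empty word. *)
Lemma coind_eq0 phi : (forall k, E k phi = 0) -> phi [::] = 0 -> phi = 0.
Proof.
move=> h h0; apply/funext => -[|k x]; first exact: h0.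
by rewrite -[LHS]/(E k phi x) h.
Qed.

(* The module is coinduced from the E's, so evaluation at the empty word
   detects operators commuting with them. *)
Lemma coind_op_eq0 (T : M -> M) : (forall k phi, E k (T phi) = T (E k phi)) ->
  (forall phi, T phi [::] = 0) -> forall phi, T phi = 0.
Proof.
move=> cT T0 phi; apply/funext => x; elim: x phi => [|k x IH] phi; first exact: T0.
by rewrite -[LHS]/(E k (T phi) x) cT IH.
Qed.

(** The Serre element commutes with all [E k], and it vanishes at the empty word because each [F]
    does. *)
Lemma F_serre i j phi : i != j -> adn `|1 - A i j|%N (F i) (F j) phi = 0.
Proof.
move=> ij; move: phi; apply: coind_op_eq0 => [k phi|phi].
  exact: gmod_serre G Adiag Ale0 A0sym _ _ _ _ ij.
elim: `|1 - A i j|%N phi => [//|n IH] phi.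
by rewrite adnS fctB IH subr0.
Qed.

Definition vac : M := fun x => (x == [::])%:R.

Lemma E_vac k : E k vac = 0.
Proof. by apply/funext => x. Qed.

Lemma H_vac i : H i vac = (lam i)%:~R *: vac.
Proof.
apply/funext => -[|k x]; rewrite fctZ /= /Hfun /vac /= ?mulr0 //.
by rewrite /word_wt big_nil subr0.
Qed.

Definition word w : M := foldr (fun i phi => F i phi) vac w.

(** The span of the [F]-words applied to [vac], given as a predicate because the ambient module is
    not a [vectType]. *)
Inductive inL : M -> Prop :=
| inL_word w : inL (word w)
| inL_lin a phi psi : inL phi -> inL psi -> inL (a *: phi + psi).

Lemma inL0 : inL 0.
Proof.
rewrite (_ : 0 = -1 *: word [::] + word [::]); first exact: inL_lin (inL_word _) (inL_word _).
by rewrite scaleN1r addNr.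
Qed.

Lemma inLZ a phi : inL phi -> inL (a *: phi).
Proof. by move=> h; rewrite -[_ *: _]addr0; apply: inL_lin h inL0. Qed.

Lemma inLD phi psi : inL phi -> inL psi -> inL (phi + psi).
Proof. by move=> h; rewrite -[phi in phi + _]scale1r; apply: inL_lin. Qed.

Lemma inL_F i phi : inL phi -> inL (F i phi).
Proof.
elim=> [w|a u v _ hu _ hv]; first exact: (inL_word (i :: w)).
by rewrite linearP; apply: inL_lin.
Qed.

Lemma inL_H i phi : inL phi -> inL (H i phi).
Proof.
elim=> [w|a u v _ hu _ hv]; last by rewrite linearP; apply: inL_lin.
elim: w => [|j w IH]; first by rewrite [word _]/vac H_vac; apply/inLZ/(inL_word [::]).
rewrite /= (gmodHF G) addrC -scaleNr; apply: inL_lin; last exact: inL_F.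
exact: (inL_word (j :: w)).
Qed.

Lemma inL_E i phi : inL phi -> inL (E i phi).
Proof.
elim=> [w|a u v _ hu _ hv]; last by rewrite linearP; apply: inL_lin.
elim: w => [|j w IH]; first by rewrite [word _]/vac E_vac; apply: inL0.
rewrite /= (gmodEF G); apply: inLD; first exact: inL_F.
by case: ifP => _; [exact/inL_H/inL_word|exact: inL0].
Qed.

(** The shifts [E i] are free on all functions, so this concerns the submodule: the Serre element
    kills [vac] and, by the opposite form of [gmod_serre], commutes with every [F k]. *)
Lemma E_serre i j phi : i != j -> inL phi -> adn `|1 - A i j|%N (E i) (E j) phi = 0.
Proof.
move=> ij; elim=> [w|a u v _ hu _ hv]; last by rewrite linearP hu hv scaler0 addr0.
elim: w => [|k w IH].
  elim: `|1 - A i j|%N => [|n IH]; first exact: E_vac.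
  by rewrite adnS IH (E_vac i) !linear0 addr0.
rewrite /= -(gmod_serre (gmodule_opp G) Adiag Ale0 A0sym _ _ ij).
by rewrite IH linear0.
Qed.

(** Nilpotency holds on [vac] and passes from a word to a longer one by [iter_ad0] and the Serre
    relation. *)
Lemma F_locally_nilpotent i phi : inL phi -> exists n, iter n (F i) phi = 0.
Proof.
have mono n m psi : iter n (F i) psi = 0 -> iter (m + n) (F i) psi = 0.
  by move=> h; rewrite iterD h; elim: m => //= m ->; rewrite linear0.
elim=> [w|a u v _ [n hn] _ [m hm]]; last first.
  exists (m + n)%N; have -> : iter (m + n) (F i) (a *: u + v) =
      a *: iter (m + n) (F i) u + iter (m + n) (F i) v.
    by elim: (m + n)%N => //= k ->; rewrite linearP.
  by rewrite mono // addnC mono // scaler0 addr0.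
elim: w => [|j w [n hn]]; last first.
  have [<-|ij] := eqVneq i j; first by exists n; rewrite -iterSr /= hn linear0.
  exists (n + `|1 - A i j|)%N; apply: iter_ad0 => // psi.
  exact: F_serre.
have [n nE] : exists n : nat, lam i = n by exists `|lam i|%N; rewrite gez0_abs.
(* The exponent is [lam i + 1]: the vector reached is killed by every [E k] and vanishes at the
   empty word. *)
exists n.+1; apply: coind_eq0 => // k.
have [->|ki] := eqVneq k i.
  have [ef hf] := gmod_sl2 G Adiag i.
  have [_ ->] := sl2_string ef hf n (E_vac i) (H_vac i).
  by rewrite nE subrr mulr0 scale0r.
elim: n.+1 => [|m IH] /=; first exact: E_vac.
by rewrite (gmodEF G) (negPf ki) addr0 IH linear0.
Qed.

Definition content x : {ffun 'I_r -> nat} := [ffun i => count_mem i x].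
(** Such a [phi] is a weight vector of weight [lam] minus [c i] copies of each simple root [i], or
    zero. *)
Definition homog c phi := forall x, phi x != 0 -> content x = c.
Definition wt_at i c : int := lam i - \sum_k A i k * (c k)%:Z.
Definition incrn c i s := iter s (fun d => incr d i) c.

Lemma incrnE c i s k : incrn c i s k = (c k + (i == k) * s)%N.
Proof.
elim: s => [|s IH]; first by rewrite muln0 addn0.
by rewrite /incrn iterS ffunE -/(incrn c i s) IH -addnA -mulnSr.
Qed.

Lemma content_cons i x : content (i :: x) = incr (content x) i.
Proof. by apply/ffunP => k; rewrite !ffunE /= addnC. Qed.

Lemma content_nseq_cat s i x : content (nseq s i ++ x) = incrn (content x) i s.
Proof. by elim: s => //= s IH; rewrite content_cons IH. Qed.

Lemma incrC c i j : incr (incr c i) j = incr (incr c j) i.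
Proof. by apply/ffunP => k; rewrite !ffunE addnAC. Qed.

Lemma wt_at_incr i c j : wt_at i (incr c j) = wt_at i c - A i j.
Proof.
rewrite /wt_at -addrA -opprD; congr (_ - _).
rewrite (bigD1 j) //= [in RHS](bigD1 j) //= ffunE eqxx PoszD mulrDr mulr1 addrAC.
by congr (_ + _ + _); apply: eq_bigr => k kj; rewrite ffunE eq_sym (negPf kj) addn0.
Qed.

Lemma word_wt_content i x : wt i x = wt_at i (content x).
Proof.
elim: x => [|k x IH].
  by rewrite /word_wt /wt_at big_nil big1 // => k _; rewrite ffunE mulr0.
by rewrite word_wt_cons IH content_cons wt_at_incr.
Qed.

Lemma homog_H c phi i : homog c phi -> H i phi = (wt_at i c)%:~R *: phi.
Proof.
move=> hc; apply/funext => x; rewrite fctZ /= /Hfun word_wt_content.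
by have [->|/hc ->] := eqVneq (phi x) 0; rewrite ?mulr0.
Qed.

Lemma iter_E s i phi x : iter s (E i) phi x = phi (nseq s i ++ x).
Proof. by elim: s phi => // s IH phi; rewrite iterSr IH. Qed.

Lemma homog_F c phi i : homog c phi -> homog (incr c i) (F i phi).
Proof.
suff h x psi : F i psi x != 0 -> exists2 y, psi y != 0 & content x = incr (content y) i.
  by move=> hc x /h [y /hc <- ->].
elim: x psi => [|k x IH] psi; first by rewrite eqxx.
rewrite -[F i psi _]/(F i (E k psi) x + (if k == i then H k psi x else 0)).
have [e0|/IH [y ey Ey] _] := eqVneq (F i (E k psi) x) 0; last first.
  by exists (k :: y); rewrite // !content_cons Ey incrC.
rewrite e0 add0r; case: (k =P i) => [->|_]; last by rewrite eqxx.
by rewrite mulf_eq0 negb_or => /andP [_ px]; exists x; rewrite ?content_cons.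
Qed.

Lemma homog_iter_F c phi i s : homog c phi -> homog (incrn c i s) (iter s (F i) phi).
Proof. by move=> hc; elim: s => //= s IH; apply: homog_F. Qed.

Lemma homog_word w : homog (content w) (word w).
Proof.
elim: w => [|i w IH]; last by rewrite content_cons; apply: homog_F.
by move=> [|i x] //; rewrite eqxx.
Qed.

Lemma homog_iter_E c phi i s d : homog c phi -> c = incrn d i s -> homog d (iter s (E i) phi).
Proof.
move=> hc Ec x; rewrite iter_E => /hc; rewrite content_nseq_cat Ec => /ffunP h.
by apply/ffunP => k; have := h k; rewrite !incrnE => /addIn.
Qed.

Lemma homog_E_nilpotent c phi i : homog c phi -> iter (c i).+1 (E i) phi = 0.
Proof.
move=> hc; apply/funext => x; rewrite iter_E; apply/eqP; apply: contraT => /hc.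
rewrite content_nseq_cat => /ffunP /(_ i); rewrite incrnE eqxx mul1n => h.
by have := leq_addl (content x i) (c i).+1; rewrite h ltnn.
Qed.

Lemma ex_last_iter (f : M -> M) phi n : phi != 0 -> iter n f phi = 0 ->
  exists t, iter t f phi != 0 /\ f (iter t f phi) = 0.
Proof.
elim: n => [/eqP //|n IH] p0 h.
by have [/IH|h'] := eqVneq (iter n f phi) 0; [apply|exists n].
Qed.

Definition weight c := exists phi, [/\ inL phi, phi != 0 & homog c phi].

Lemma weight0 : weight [ffun=> 0%N].
Proof.
exists (word [::]); split; first exact: inL_word.
  by apply/eqP => /(congr1 (fun f : M => f [::])) /eqP; rewrite oner_eq0.
by rewrite (_ : [ffun=> 0%N] = content [::]); [apply: homog_word|apply/ffunP => i; rewrite !ffunE].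
Qed.

Lemma inL_iter (f : M -> M) s phi : (forall psi, inL psi -> inL (f psi)) ->
  inL phi -> inL (iter s f phi).
Proof. by move=> h hp; elim: s => //= s; apply: h. Qed.

Let sl2F i := gmod_sl2 G Adiag i.
Let sl2E i := gmod_sl2 (gmodule_opp G) Adiag i.

(** If [F i] killed [phi], then [phi] would have negative weight for [H i] and start an unbreakable
    [E i]-string, but [E i] is nilpotent on it. *)
Lemma weight_down c i : weight c -> 0 < wt_at i c -> weight (incr c i).
Proof.
move=> [phi [hL p0 hc]] wi; exists (F i phi).
split; [exact: inL_F| |exact: homog_F].
apply/eqP => F0; have [ef hf] := sl2E i.
have Hp : neg_lin (H i) phi = - (wt_at i c)%:~R *: phi.
  by rewrite /neg_lin /= (homog_H _ hc) scaleNr.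
have nt t : (t < (c i).+1)%N -> - (wt_at i c)%:~R != t%:R :> K.
  by move=> _; rewrite lt_eqF // (lt_le_trans _ (ler0n _ _)) // oppr_lt0 ltr0z.
by have := sl2_string_neq0 ef hf F0 Hp p0 nt; rewrite (homog_E_nilpotent _ hc) eqxx.
Qed.

Lemma wt_at_incrn c i s : wt_at i (incrn c i s) = wt_at i c - s%:Z * 2.
Proof.
elim: s => [|s IH]; first by rewrite mul0r subr0.
by rewrite [incrn _ _ _]/(incr (incrn c i s) i) wt_at_incr IH Adiag; lia.
Qed.

Lemma iter_E_neq0 c phi i s : homog c phi -> iter s (E i) phi != 0 ->
  exists d, c = incrn d i s.
Proof.
move=> hc n0; suff [x px] : exists x, iter s (E i) phi x != 0.
  by exists (content x); rewrite -content_nseq_cat (hc _ _) // -iter_E.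
apply: contrapT => h; case/eqP: n0; apply/funext => x; apply/eqP.
by apply: contraT => px; case: h; exists x.
Qed.

(** For a nonnegative weight, climb to the top of the [E i]-string and descend by [F i] to the
    mirror position. For a negative one, exchange the two operators, using that [F i] is locally
    nilpotent. *)
Lemma weight_reflection c i : weight c ->
  exists2 c', weight c' & forall k, (c' k)%:Z = (c k)%:Z + (i == k)%:Z * wt_at i c.
Proof.
move=> [phi [hL p0 hc]]; have [wi|wi] := leP 0 (wt_at i c).
  have [t [y0 Ey]] := ex_last_iter p0 (homog_E_nilpotent i hc).
  set y := iter t (E i) phi in y0 Ey.
  have [d hd] := iter_E_neq0 hc y0.
  have hy : homog d y := homog_iter_E hc hd.
  have [ef hf] := sl2F i.
  have wd : wt_at i d = (`|wt_at i c|%N + t * 2)%N.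
    by rewrite hd wt_at_incrn in wi *; lia.
  (* The vector [y] has weight [wt_at i c + 2 * t], so its string is at least [s] steps long; the
     reflected weight lies [s] steps below [y]. *)
  pose s := (`|wt_at i c|%N + t)%N.
  exists (incrn d i s).
    exists (iter s (F i) y); split; last exact: homog_iter_F.
      by apply: inL_iter (inL_F _) _; apply: inL_iter (inL_E _) _.
    apply: (sl2_string_neq0 ef hf Ey (homog_H _ hy) y0) => u us.
    rewrite wd -pmulrn eqr_nat gtn_eqF // (leq_trans us) // /s; lia.
  move=> k; rewrite {1}hd !incrnE /s PoszD PoszM; case: eqP => _; lia.
have [n /(ex_last_iter p0) [t [y0 Fy]]] := F_locally_nilpotent i hL.
set y := iter t (F i) phi in y0 Fy.
have hy : homog (incrn c i t) y by apply: homog_iter_F.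
have [ef hf] := sl2E i.
pose s := (`|wt_at i c|%N + t)%N.
have Hp : neg_lin (H i) y = (s + t)%:R *: y.
  rewrite /neg_lin /= (homog_H _ hy) -scaleNr wt_at_incrn; congr (_ *: _).
  by rewrite -mulrNz (pmulrn _ (s + t)); congr (_ *~ _); rewrite /s; lia.
have z0 : iter s (E i) y != 0.
  apply: (sl2_string_neq0 ef hf Fy Hp y0) => u us.
  by rewrite eqr_nat gtn_eqF // (leq_trans us) // leq_addr.
have [d hd] := iter_E_neq0 hy z0.
exists d; last first.
  move=> k; have /ffunP /(_ k) := hd; rewrite !incrnE /s; case: eqP => _; lia.
exists (iter s (E i) y); split=> //; last exact: homog_iter_E hy hd.
by apply: inL_iter (inL_E _) _; apply: inL_iter (inL_F _) _.
Qed.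

End IrreducibleModule.

(** * Finite dimensionality and irreducibility *)

Section FiniteDimensional.
Variables (K : numFieldType) (r : nat).
Variables (A : 'I_r -> 'I_r -> int) (lam : 'I_r -> int).
Hypothesis Adiag : forall i, A i i = 2.
Hypothesis Ale0 : forall i j, i != j -> A i j <= 0.
Hypothesis A0sym : forall i j, A i j = 0 -> A j i = 0.
Hypothesis lam_ge0 : forall i, 0 <= lam i.
Variable N : nat.
Hypothesis weight_bounded : forall c, weight K A lam c -> (\sum_i c i <= N)%N.

Local Notation M := (seq 'I_r -> K^o).
Implicit Types (phi psi : M) (i j k : 'I_r) (x y w : seq 'I_r).
Local Notation E := (@Eop K r).
Local Notation F := (@Fop K r A lam).
Local Notation H := (@Hop K r A lam).
Local Notation inL := (@inL K r A lam).
Local Notation word := (@word K r A lam).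
Local Notation vac := (@vac K r).

Let G : gmodule A E F H := coinduced_gmodule K A lam.

Lemma size_content x : (\sum_i content x i)%N = size x.
Proof.
elim: x => [|i x IH] /=; first by rewrite big1 // => i _; rewrite ffunE.
rewrite content_cons -IH (bigD1 i) //= [in RHS](bigD1 i) //= ffunE eqxx addn1 addSn.
by congr (_ + _).+1; apply: eq_bigr => j ji; rewrite ffunE eq_sym (negPf ji) addn0.
Qed.

(** A word in the support of [word w] has the content of [w], which is then a weight, and its length
    is the sum of that content. *)
Lemma inL_support phi x : inL phi -> phi x != 0 -> (size x <= N)%N.
Proof.
move=> hL; apply: contraNT; rewrite -ltnNge => Nx; elim: hL => [w|a u v _ /eqP hu _ /eqP hv].
  apply: contraTT Nx => wx; rewrite -leqNgt -size_content (homog_word wx).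
  apply: weight_bounded; exists (word w); split; [exact: inL_word| |exact: homog_word].
  by apply: contraNneq wx => ->.
by rewrite fctD fctZ hu hv mulr0 addr0.
Qed.

Local Notation W := {ffun {bseq N of 'I_r} -> K^o}.
(** Functions on words of length at most [N] form a [vectType]. On the submodule nothing is lost,
    and extension by zero inverts truncation. *)
Definition truncate phi : W := [ffun w : {bseq N of 'I_r} => phi w].
Definition extend (g : W) : M := fun x => oapp g 0 (insub x : option {bseq N of 'I_r}).

Lemma truncate_is_linear : linear truncate.
Proof. by move=> a u v; apply/ffunP => w; rewrite !ffunE. Qed.

Lemma extend_is_linear : linear extend.
Proof.
move=> a u v; apply/funext => x; rewrite fctD fctZ /extend.
by case: insubP => [w _ _|_] /=; rewrite ?ffunE // mulr0 addr0.
Qed.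

HB.instance Definition _ := GRing.isLinear.Build K M W _ truncate truncate_is_linear.
HB.instance Definition _ := GRing.isLinear.Build K W M _ extend extend_is_linear.

Lemma truncateK phi : inL phi -> extend (truncate phi) = phi.
Proof.
move=> hL; apply/funext => x; rewrite /extend.
case: insubP => [w _ <-|]; first by rewrite /= ffunE.
by apply: contraNeq => h; apply: inL_support hL _; rewrite eq_sym.
Qed.

Lemma extendK : cancel extend truncate.
Proof. by move=> g; apply/ffunP => w; rewrite ffunE /extend valK. Qed.

(** Short words suffice, as [word w] is zero when [w] is longer than [N]. *)
Definition Lspace : {vspace W} :=
  (\sum_(w : {bseq N of 'I_r}) <[truncate (word w)]>)%VS.
Local Notation V := (subvs_of Lspace).

Lemma truncate_in phi : inL phi -> truncate phi \in Lspace.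
Proof.
elim=> [w|a u v _ hu _ hv]; last by rewrite linearP; apply: rpredD => //; apply: rpredZ.
have [w0|w0] := eqVneq (word w) 0; first by rewrite w0 linear0 mem0v.
have wN : (size w <= N)%N.
  rewrite -size_content; apply: weight_bounded; exists (word w); split=> //.
    exact: inL_word.
  exact: homog_word.
by apply: (subvP (sumv_sup (Bseq wN) _ (subvv _))); rewrite ?memv_line.
Qed.

Lemma extend_inL g : g \in Lspace -> inL (extend g).
Proof.
case/memv_sumP => f hf ->; rewrite linear_sum /=.
elim/big_rec: _ => [|w u _ hu]; first exact: inL0.
apply: inLD => //; have /vlineP [a ->] := hf w isT.
by rewrite linearZ /=; apply: inLZ; rewrite truncateK; apply: inL_word.
Qed.

(** Identities between endomorphisms of [V] are checked after [emb], in the module of functions;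
    [ret] goes back. *)
Definition emb (u : V) : M := extend (vsval u).
Definition ret phi : V := vsproj Lspace (truncate phi).

Lemma emb_is_linear : linear emb.
Proof. by move=> a u v; rewrite /emb !linearP. Qed.
Lemma ret_is_linear : linear ret.
Proof. by move=> a u v; rewrite /ret !linearP. Qed.
HB.instance Definition _ := GRing.isLinear.Build K V M _ emb emb_is_linear.
HB.instance Definition _ := GRing.isLinear.Build K M V _ ret ret_is_linear.

Lemma emb_inj : injective emb.
Proof. by move=> u v /(can_inj extendK) /val_inj. Qed.

Lemma emb_inL u : inL (emb u).
Proof. by apply: extend_inL; apply: subvsP. Qed.

Lemma retK phi : inL phi -> emb (ret phi) = phi.
Proof. by move=> h; rewrite /emb vsprojK ?truncate_in // truncateK. Qed.

Definition restr (T : {linear M -> M}) : 'End(V) := linfun (ret \o T \o emb).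

Lemma emb_restr (T : {linear M -> M}) u : (forall phi, inL phi -> inL (T phi)) ->
  emb (restr T u) = T (emb u).
Proof. by move=> h; rewrite lfunE /= retK //; apply/h/emb_inL. Qed.

Definition Emx i := restr (E i).
Definition Fmx i := restr (F i).
Definition Hmx i := restr (H i).

Lemma emb_E i u : emb (Emx i u) = E i (emb u).
Proof. by apply: emb_restr => phi; apply: inL_E. Qed.
Lemma emb_F i u : emb (Fmx i u) = F i (emb u).
Proof. by apply: emb_restr => phi; apply: inL_F. Qed.
Lemma emb_H i u : emb (Hmx i u) = H i (emb u).
Proof. by apply: emb_restr => phi; apply: inL_H. Qed.

Lemma emb_lie (f g : 'End(V)) u : emb (lie f g u) = emb (f (g u)) - emb (g (f u)).
Proof. by rewrite /lie !lfunE /= opp_lfunE !lfunE /= linearB. Qed.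

Lemma emb_iter_lie n (f g : 'End(V)) (f' g' : {linear M -> M}) u :
  (forall v, emb (f v) = f' (emb v)) -> (forall v, emb (g v) = g' (emb v)) ->
  emb (iter n (lie f) g u) = adn n f' g' (emb u).
Proof.
by move=> hf hg; elim: n u => [|n IH] u //=; rewrite emb_lie hf !IH hf.
Qed.

Lemma lfun_eq_emb (f g : 'End(V)) : (forall u, emb (f u) = emb (g u)) -> f = g.
Proof. by move=> h; apply/lfunP => u; apply: emb_inj. Qed.

Lemma vac_vec : {v : V | emb v = vac}.
Proof. by exists (ret vac); rewrite retK //; apply: (@inL_word K r A lam [::]). Qed.

(** From any nonzero vector of a stable subspace, the operators [E] lead to a nonzero multiple of
    [vac], from which the [F]-words generate everything. *)
Lemma irreducible_restr : irreducible_rep Emx Fmx Hmx.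
Proof.
have [v0 v0E] := vac_vec; have vac0 : vac != 0.
  by apply/eqP => /(congr1 (fun f : M => f [::])) /eqP; rewrite oner_eq0.
split.
  apply/eqP => h; have := memvf v0; rewrite h memv0 => /eqP v00.
  by case/eqP: vac0; rewrite -v0E v00 linear0.
move=> U stab; have [->|U0] := eqVneq U 0%VS; [by left|right].
have sE i u : u \in U -> Emx i u \in U.
  by move=> uU; have [h _ _] := stab i; apply: (subvP h); rewrite memv_img.
have sF i u : u \in U -> Fmx i u \in U.
  by move=> uU; have [_ h _] := stab i; apply: (subvP h); rewrite memv_img.
have vU : v0 \in U.
  have base u : u \in U -> u != 0 -> ~ (exists i, Emx i u != 0) -> v0 \in U.
    move=> uU u0 h; have uE : emb u = emb u [::] *: vac.
      apply/subr0_eq/coind_eq0 => [k|]; last by rewrite fctB fctZ mulr1 subrr.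
      rewrite (linearB (E k)) (linearZ_LR (E k)) E_vac scaler0 subr0 -emb_E.
      have [->|Ek] := eqVneq (Emx k u) 0; first exact: linear0.
      by case: h; exists k.
    have c0 : emb u [::] != 0.
      apply: contraNneq u0 => c0; apply/eqP/emb_inj.
      by rewrite uE c0 scale0r linear0.
    rewrite (_ : v0 = (emb u [::])^-1 *: u) ?rpredZ //.
    apply: emb_inj; rewrite linearZ /= v0E; apply: (canRL (scalerK _)); last exact: esym.
    exact: c0.
  (* Each [E i] shortens the words of the support by one letter, so their maximal length
     decreases. *)
  have up n u : u \in U -> u != 0 -> (forall x, emb u x != 0 -> (size x <= n)%N) -> v0 \in U.
    elim: n u => [|n IH] u uU u0 hn; have [[i Ei]|h] := pselect (exists i, Emx i u != 0).
    + case/eqP: Ei; apply: emb_inj; rewrite emb_E linear0; apply/funext => x.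
      by apply/eqP; apply: contraT => /hn.
    + exact: base uU u0 h.
    + by apply: (IH _ (sE i u uU) Ei) => x; rewrite emb_E => /hn.
    + exact: base uU u0 h.
  have := vpick0 U; rewrite (negPf U0) => /negbT p0.
  by apply: (up N _ (memv_pick U) p0) => x; apply/inL_support/emb_inL.
apply/eqP; rewrite eqEsubv subvf; apply/subvP => u _.
have wU w : ret (word w) \in U.
  elim: w => [|i w IH].
    by rewrite (_ : ret (word [::]) = v0) //; apply: emb_inj; rewrite v0E retK //; apply: inL_word.
  rewrite (_ : ret _ = Fmx i (ret (word w))) ?sF //.
  apply: emb_inj; rewrite emb_F !retK //; first exact: inL_word.
  exact: (@inL_word K r A lam (i :: w)).
suff h phi : inL phi -> ret phi \in U.
  have -> : u = ret (emb u) by apply: emb_inj; rewrite retK //; apply: emb_inL.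
  exact/h/emb_inL.
by elim=> [w|a f g _ hf _ hg] //; rewrite linearP; apply: rpredD => //; apply: rpredZ.
Qed.

Lemma weight_vec c : weight K A lam c ->
  exists2 u : V, u != 0 & forall i, Hmx i u = (wt_at A lam i c)%:~R *: u.
Proof.
move=> [phi [hL p0 hc]]; exists (ret phi).
  by apply: contraNneq p0 => h; rewrite -(retK hL) h linear0.
by move=> i; apply: emb_inj; rewrite emb_H linearZ /= retK // (homog_H _ _ _ hc).
Qed.

Lemma highest_vec : exists v : V, [/\ v != 0, forall i, Emx i v = 0 &
  forall i, Hmx i v = (lam i)%:~R *: v].
Proof.
have [v0 v0E] := vac_vec; exists v0; split.
- apply/eqP => h; move: v0E; rewrite h linear0 => /(congr1 (fun f : M => f [::])) /esym /eqP.
  by rewrite oner_eq0.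
- by move=> i; apply: emb_inj; rewrite emb_E v0E E_vac linear0.
by move=> i; apply: emb_inj; rewrite emb_H linearZ /= v0E H_vac.
Qed.

End FiniteDimensional.

Lemma irrep_exists (K : numFieldType) (r : nat) (D : root_datum r)
    (alpha : 'I_r -> 'rV[int]_r) (lam : 'rV[int]_r) (N : nat) :
    let A i j := pairing (alpha j) (coroot D (alpha i)) in
    let l i := pairing lam (coroot D (alpha i)) in
    is_base D alpha ->
    (forall c, weight K A l c -> (\sum_i c i <= N)%N) ->
  forall mu c, weight K A l c -> mu = lam - \sum_i (c i)%:Z *: alpha i ->
  weight_of_irrep D alpha K lam mu.
Proof.
move=> A l baseD bd mu c wc muE.
have Ad : forall i, A i i = 2 := cartan_diag baseD.
have Al : forall i j, i != j -> A i j <= 0 := cartan_le0 baseD.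
have As : forall i j, A i j = 0 -> A j i = 0 := cartan_eq0 baseD.
have G := coinduced_gmodule K A l.
have eE := emb_E bd; have eF := emb_F bd; have eH := emb_H bd.
have e0 (u : subvs_of (Lspace K A l N)) : emb ((0 : 'End(subvs_of (Lspace K A l N))) u) = 0.
  by rewrite lfunE /= linear0.
exists (subvs_of (Lspace K A l N)), (Emx K A l N), (Fmx K A l N), (Hmx K A l N); split.
- split=> i j.
  + apply: lfun_eq_emb => u; rewrite emb_lie e0 !eH.
    by rewrite (gmodHH G) subrr.
  + apply: lfun_eq_emb => u; rewrite emb_lie !(eE, eF).
    rewrite (gmodEF G) addrAC subrr add0r.
    by case: eqP => _; rewrite ?eH ?e0.
  + split; apply: lfun_eq_emb => u.
      by rewrite emb_lie !(eH, eE) scale_lfunE linearZ /= eE (gmodHE G) addrAC subrr add0r.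
    by rewrite emb_lie !(eH, eF) scale_lfunE linearZ /= eF (gmodHF G) addrAC subrr add0r scaleNr.
  move=> ij; split; apply: lfun_eq_emb => u; rewrite e0.
    rewrite (emb_iter_lie _ _ (eE i) (eE j)).
    exact: (E_serre Ad Al As ij (emb_inL bd u)).
  rewrite (emb_iter_lie _ _ (eF i) (eF j)).
  exact: (F_serre l Ad Al As (emb u) ij).
- exact: irreducible_restr.
- by have [v [v0 ev hv]] := highest_vec bd; exists v.
have [u u0 hu] := weight_vec bd wc.
exists u => // i; rewrite hu muE; congr (_%:~R *: _).
rewrite pairingB pairing_sum; congr (_ - _); apply: eq_bigr => k _.
by rewrite pairingZ mulrC.
Qed.

(** * Weights of irreducible representations *)

Section WeightsOfIrreducible.
Variables (K : numFieldType) (r : nat) (D : root_datum r).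
Hypothesis scD : simply_connected D.
Variable alpha : 'I_r -> 'rV[int]_r.
Hypothesis baseD : is_base D alpha.
Variables (V : vectType K) (e f h : 'I_r -> 'End(V)).
Hypothesis rep : is_representation D alpha e f h.
Variables (lam : 'rV[int]_r) (v : V).
Hypothesis ev : forall i, e i v = 0.
Hypothesis hv : in_weight_space D alpha h lam v.
Implicit Types (i j : 'I_r) (w : seq 'I_r).

Definition fword w : V := foldr (fun i u => f i u) v w.
Definition fweight w : 'rV[int]_r := lam - \sum_(k <- w) alpha k.

Lemma fword_weight w : in_weight_space D alpha h (fweight w) (fword w).
Proof.
case: rep => _ _ hef _; elim: w => [|j w IH] i; first by rewrite /fweight big_nil subr0 hv.
have [_ /(congr1 (fun g : 'End(V) => g (fword w)))] := hef i j.
rewrite /lie add_lfunE opp_lfunE !comp_lfunE scale_lfunE IH linearZ /= => /eqP.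
rewrite subr_eq -scalerDl => /eqP ->; congr (_ *: _).
rewrite -rmorphN -rmorphD /=; congr (_%:~R).
have -> : fweight (j :: w) = fweight w - alpha j by rewrite /fweight big_cons opprD addrA addrAC.
by rewrite (pairingB (fweight w)) addrC.
Qed.

(** A finite list whose span has maximal dimension cannot be enlarged. *)
Lemma fword_span : exists s, forall w, fword w \in <<map fword s>>%VS.
Proof.
pose P n := `[< exists s, \dim <<map fword s>> = n >].
have P0 : exists n, P n by exists (\dim <<map fword [::]>>); apply/asboolP; exists [::].
have Pb n : P n -> (n <= \dim (fullv : {vspace V}))%N.
  by move=> /asboolP [s <-]; apply: dimvS; apply: subvf.
case: (ex_maxnP P0 Pb) => m /asboolP [s sm] mx; exists s => w.
have sub : (<<map fword s>> <= <<map fword (w :: s)>>)%VS.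
  by rewrite /= span_cons addvSr.
have : (<<map fword s>> == <<map fword (w :: s)>>)%VS.
  by rewrite eqEdim sub sm mx //; apply/asboolP; exists (w :: s).
by move=> /eqP ->; rewrite memv_span // mem_head.
Qed.

(** The span of the words is stable under [f] by construction, under [h] by weights, and under [e]
    by moving it to the right until it meets [v]. *)
Lemma fword_full : irreducible_rep e f h -> v != 0 -> exists s, <<map fword s>>%VS = fullv.
Proof.
move=> irr v0; have [s hs] := fword_span; exists s.
set U := <<_>>%VS in hs *.
have stab (g : 'End(V)) : (forall w, g (fword w) \in U) -> (g @: U <= U)%VS.
  move=> gU; rewrite limg_span; apply/span_subvP => x /mapP [y /mapP [w _ ->] ->].
  exact: gU.
have sf i : (f i @: U <= U)%VS by apply: stab => w; apply: (hs (i :: w)).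
have sh i w : h i (fword w) \in U by rewrite fword_weight rpredZ.
have se i w : e i (fword w) \in U.
  case: rep => _ ef _ _; elim: w => [|j w IH]; first by rewrite [e i _]ev mem0v.
  have /(congr1 (fun g : 'End(V) => g (fword w))) := ef i j.
  rewrite /lie add_lfunE opp_lfunE !comp_lfunE => /eqP; rewrite subr_eq => /eqP /= ->.
  rewrite rpredD //; last by apply: (subvP (sf j)); rewrite memv_img.
  by case: eqP => _; rewrite ?sh // zero_lfunE mem0v.
case: irr => _ /(_ U) [] // => [i|U0].
  by split; [apply: stab|apply: sf|apply: stab].
by have := hs [::]; rewrite U0 memv0 (negPf v0).
Qed.

(** Otherwise, choose for each word a simple coroot separating [mu] from its weight. The product of
    the operators [h (g w) - p w] over a spanning list kills [V], yet scales [u] by a nonzero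
    factor. *)
Lemma weight_below mu u : irreducible_rep e f h -> v != 0 -> u != 0 ->
  in_weight_space D alpha h mu u -> exists w, mu = fweight w.
Proof.
move=> irr v0 u0 hu; have [s sfull] := fword_full irr v0.
apply: contrapT => nw.
have sep w : exists i, pairing (mu - fweight w) (coroot D (alpha i)) != 0.
  apply: contrapT => hw; apply: nw; exists w; apply/subr0_eq/toQ_inj.
  rewrite raddf0; apply: (pairing_simple_inj scD baseD) => i.
  rewrite pairing_toQ; apply/eqP; rewrite intr_eq0; apply: contraT => hi.
  by case: hw; exists i.
have {sep} [g hg] := choice sep.
pose p w : K := (pairing (fweight w) (coroot D (alpha (g w))))%:~R.
pose P t := foldr (fun w T => ((h (g w) - p w *: \1) \o T)%VF) \1%VF t.
have PE nu x t : in_weight_space D alpha h nu x -> P t x =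
    (\prod_(w <- t) (pairing (nu - fweight w) (coroot D (alpha (g w))))%:~R) *: x.
  move=> hx; elim: t => [|w t IH] /=; first by rewrite id_lfunE big_nil scale1r.
  rewrite comp_lfunE IH linearZ /= add_lfunE opp_lfunE scale_lfunE id_lfunE hx.
  by rewrite -scalerBl scalerA big_cons mulrC pairingB rmorphB.
have Pu : P s u = 0.
  have : u \in <<map fword s>>%VS by rewrite sfull memvf.
  suff /subvP sub : (<<map fword s>> <= lker (P s))%VS by move/sub; rewrite memv_ker => /eqP.
  apply/span_subvP => x /mapP [w ws ->]; rewrite memv_ker (PE _ _ _ (fword_weight w)).
  by rewrite (big_rem w) //= subrr pairing0 mul0r scale0r.
move: Pu; rewrite (PE _ _ _ hu) => /eqP; rewrite scaler_eq0 (negPf u0) orbF.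
by rewrite prodf_seq_eq0 => /hasP [w _ /=]; rewrite intr_eq0 (negPf (hg w)).
Qed.

End WeightsOfIrreducible.

(** * The Kostka cone and the intersection polytopes *)

Section Polyhedral.
Variables (K : numFieldType) (r : nat) (D : root_datum r).
Hypothesis scD : simply_connected D.
Variable alpha : 'I_r -> 'rV[int]_r.
Hypothesis baseD : is_base D alpha.
Variable varpi : 'I_r -> 'rV[rat]_r.
Hypothesis varpiE : fundamental_weights D alpha varpi.
Implicit Types (x y v l m : 'rV[rat]_r) (lam mu : 'rV[int]_r) (i j : 'I_r)
  (c k : {ffun 'I_r -> nat}).

Local Notation al i := (toQ (alpha i)).
Local Notation pr v i := (pairing v (coroot D (alpha i))).
Local Notation s_ i := (reflection D (alpha i)).
Local Notation coef := (coef alpha).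
Local Notation pos := (pos alpha).
Local Notation dom := (dominant_cone D alpha).
Local Notation down := (down alpha).
Local Notation A := (fun i j => pairing (alpha j) (coroot D (alpha i))).
Local Notation hw lam := (fun i => pairing lam (coroot D (alpha i))).

Definition below p := [/\ dom p.1, dom p.2 & pos (p.1 - p.2)].

Lemma pairing_down lam c i : pr (down (toQ lam) c) i = (wt_at A (hw lam) i c)%:~R.
Proof.
rewrite /down pairingB pairing_toQ pairing_sum /wt_at intrB [X in _ = _ - X]rmorph_sum /=.
by congr (_ - _); apply: eq_bigr => k _; rewrite pairingZ pairing_toQ intrM mulrC.
Qed.

Lemma down_toQ lam c : down (toQ lam) c = toQ (lam - \sum_i (c i)%:Z *: alpha i).
Proof.
rewrite /down raddfB /=; congr (_ - _); rewrite raddf_sum.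
by apply: eq_bigr => i _; rewrite /= toQZ.
Qed.

Section Weights.
Variable lam : 'rV[int]_r.
Hypothesis lam_dom : dom (toQ lam).

Local Notation weight c := (weight K A (hw lam) c).

Let Ad : forall i, A i i = 2 := cartan_diag baseD.
Let Al : forall i j, i != j -> A i j <= 0 := cartan_le0 baseD.
Let As : forall i j, A i j = 0 -> A j i = 0 := cartan_eq0 baseD.
Lemma hw_ge0 i : 0 <= hw lam i.
Proof. by have := lam_dom i; rewrite pairing_toQ ler0z. Qed.

Lemma weight_reflection_down c i : weight c ->
  exists2 c', weight c' & down (toQ lam) c' = s_ i (down (toQ lam) c).
Proof.
move=> wc; have [c' wc' E] := weight_reflection Ad Al As hw_ge0 i wc; exists c' => //.
rewrite /reflection pairing_down /down -addrA -opprD; congr (_ - _).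
have -> : (wt_at A (hw lam) i c)%:~R *: al i =
    \sum_j ((i == j)%:Z * wt_at A (hw lam) i c)%:~R *: al j.
  rewrite (bigD1 i) //= eqxx mul1r big1 ?addr0 // => j /negPf.
  by rewrite eq_sym => ->; rewrite mul0r scale0r.
rewrite -big_split; apply: eq_bigr => j _ /=.
by rewrite -scalerDl pmulrn E rmorphD.
Qed.

Lemma weight_bound : exists N, forall c, weight c -> (\sum_i c i <= N)%N.
Proof.
by apply: (reflection_stable_bounded baseD varpiE lam_dom) => c i; apply: weight_reflection_down.
Qed.

Lemma weight_of_irrep_below mu : below (toQ lam, toQ mu) ->
  (exists k, mu = lam - \sum_i (k i)%:Z *: alpha i) -> weight_of_irrep D alpha K lam mu.
Proof.
move=> [_ dmu _] [k muE]; have [N bd] := weight_bound.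
apply: (irrep_exists baseD bd _ muE).
apply: (dominant_descent scD baseD (S := fun c => weight c) (lam := toQ lam)).
- exact: weight0.
- by move=> c i wc; rewrite pairing_down ltr0z; apply: weight_down.
by rewrite down_toQ -muE.
Qed.

End Weights.

Lemma posZ t x : 0 <= t -> pos x -> pos (t *: x).
Proof. by move=> t0 px i; rewrite coefZ mulr_ge0. Qed.

Lemma posD x y : pos x -> pos y -> pos (x + y).
Proof. by move=> px py i; rewrite coefD addr_ge0. Qed.

Lemma pos0 : pos 0.
Proof. by move=> i; rewrite coef0. Qed.

Lemma domZ t x : 0 <= t -> dom x -> dom (t *: x).
Proof. by move=> t0 dx i; rewrite pairingZ mulr_ge0. Qed.

Lemma domD x y : dom x -> dom y -> dom (x + y).
Proof. by move=> dx dy i; rewrite pairingD addr_ge0. Qed.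

Lemma dom0 : dom 0.
Proof. by move=> i; rewrite pairing0. Qed.

Lemma belowZ t p : 0 <= t -> below p -> below (t *: p).
Proof.
move=> t0 [dl dm pm]; split; [exact: domZ|exact: domZ|].
by rewrite /= -scalerBr; apply: posZ.
Qed.

Lemma belowD p q : below p -> below q -> below (p + q).
Proof.
move=> [dl dm pm] [dl' dm' pm']; split; [exact: domD|exact: domD|].
by rewrite /= opprD addrACA; apply: posD.
Qed.

(** The multiple must also bring [l - m] into the root lattice, where differences of weights of an
    irreducible representation lie. *)
Lemma below_integral l m : below (l, m) -> exists2 N : nat, (0 < N)%N &
  exists lam k, N%:R *: l = toQ lam /\ N%:R *: m = down (toQ lam) k.
Proof.
move=> [/= _ _ plm]; have [N1 N10 [lam E]] := rV_common_denominator l.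
have [N2 N20 h] := ex_common_denominator (fun i => coef (l - m) i).
exists (N2 * N1)%N; first by rewrite muln_gt0 N10 N20.
have {h} [k hk] : exists k : {ffun 'I_r -> nat}, forall i, (N2 * N1)%:R * coef (l - m) i = (k i)%:R.
  have /choice [g hg] i : exists n : nat, N2%:R * coef (l - m) i = n%:R.
    have [z hz] := h i; exists `|z|%N; rewrite natr_absz ger0_norm ?hz //.
    by rewrite -(ler0z rat) -hz mulr_ge0.
  exists [ffun i => (g i * N1)%N] => i.
  by rewrite ffunE !natrM mulrAC hg.
exists (N2%:Z *: lam), k; rewrite toQZ -E scalerA natrM; split=> //.
rewrite /down -(eq_bigr _ (fun i _ => congr1 (fun t => t *: al i) (hk i))).
under eq_bigr do rewrite -scalerA.
by rewrite -scaler_sumr -(coefE baseD) -natrM -scalerBr subKr.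
Qed.

(** Generators satisfy the inequalities by [weight_below]. Conversely, a positive multiple of any
    solution is itself a generator. *)
Lemma kostka_coneE : kostka_cone K D alpha = [set p | below p].
Proof.
apply/seteqP; split=> p /=.
  move=> [n [c [q [c0 hq ->]]]].
  elim/big_rec: _ => [|i u _ hu].
    by split; [exact: dom0|exact: dom0|rewrite subr0; exact: pos0].
  apply: belowD => //; apply: belowZ => //.
  have [lam [mu [-> dl dm [V [e [f [h [rep irr [v [v0 ev hv]] [u' u0 hu']]]]]]]]] := hq i.
  split=> //=; have [w ->] := weight_below scD baseD rep ev hv irr v0 u0 hu'.
  rewrite /fweight raddfB /= subKr raddf_sum => j.
  elim/big_rec: _ => [|k x _ hx]; first exact: pos0.
  by rewrite coefD addr_ge0 // (coef_simple baseD) ler0n.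
case: p => l m hlm; have [N N0 [lam [k [El Em]]]] := below_integral hlm.
have Nr : (N%:R : rat) != 0 by rewrite pnatr_eq0 -lt0n.
rewrite down_toQ in Em; set mu := lam - _ in Em.
have hb : below (toQ lam, toQ mu).
  by rewrite -El -Em; apply: (belowZ (p := (l, m))).
exists 1%N, (fun=> N%:R^-1), (fun=> (toQ lam, toQ mu)); split.
- by move=> _; rewrite invr_ge0 ler0n.
- move=> _; exists lam, mu; have [dl dm _] := hb; split=> //.
  by apply: (weight_of_irrep_below dl hb); exists k.
by rewrite big_ord1 -El -Em; congr (_, _); rewrite /= scalerA mulVf // scale1r.
Qed.

End Polyhedral.

(** * Convex hulls *)

Section ConvexHull.
Variable V : lmodType rat.
Implicit Types (S : set V) (x y : V).

Lemma conv_hull_subset S : S `<=` conv_hull S.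
Proof.
move=> x Sx; exists 1%N, (fun=> 1), (fun=> x); split=> //.
- by rewrite big_ord1.
by rewrite big_ord1 scale1r.
Qed.

Lemma conv_hull_convex S x y t : conv_hull S x -> conv_hull S y -> 0 <= t <= 1 ->
  conv_hull S ((1 - t) *: x + t *: y).
Proof.
move=> [n [c [p [c0 c1 Sp ->]]]] [n' [c' [p' [c0' c1' Sp' ->]]]] /andP [t0 t1].
exists (n + n')%N,
  (fun i => match fintype.split i with inl j => (1 - t) * c j | inr j => t * c' j end),
  (fun i => match fintype.split i with inl j => p j | inr j => p' j end); split.
- by move=> i; case: fintype.split => j; rewrite mulr_ge0 // subr_ge0.
- rewrite big_split_ord /= (eq_bigr (fun j => (1 - t) * c j)) => [|j _]; last first.
    by rewrite (unsplitK (inl j)).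
  rewrite -mulr_sumr c1 (eq_bigr (fun j => t * c' j)) => [|j _]; last first.
    by rewrite (unsplitK (inr j)).
  by rewrite -mulr_sumr c1' !mulr1 subrK.
- by move=> i; case: fintype.split.
rewrite big_split_ord /= !scaler_sumr; congr (_ + _); apply: eq_bigr => j _.
  by rewrite (unsplitK (inl j)) scalerA.
by rewrite (unsplitK (inr j)) scalerA.
Qed.

Lemma conv_hull_linear S (S' : set V) (f : V -> V) x : linear f ->
  (forall y, S y -> S' (f y)) -> conv_hull S x -> conv_hull S' (f x).
Proof.
move=> fl fS [n [c [p [c0 c1 Sp ->]]]]; exists n, c, (f \o p); split=> //.
  by move=> i; apply: fS.
have f0 : f 0 = 0 by have := fl (-1) 0 0; rewrite scaler0 addr0 scaleN1r addNr.
elim/big_rec2: _ => [//|i y z _ <-]; exact: fl.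
Qed.

End ConvexHull.

(** * The Weyl polytope and the dominance order *)

Section IntersectionPolytope.
Variables (r : nat) (D : root_datum r).
Hypothesis scD : simply_connected D.
Variable alpha : 'I_r -> 'rV[int]_r.
Hypothesis baseD : is_base D alpha.
Implicit Types (l m : 'rV[rat]_r) (lam : 'rV[int]_r) (i : 'I_r).

Local Notation dom := (dominant_cone D alpha).
Local Notation pos := (pos alpha).
Local Notation wact := (wact D alpha).
Local Notation below := (below D alpha).

Lemma wact_is_linear s : linear (wact s).
Proof. by move=> c x y; elim: s => //= i s ->; rewrite linearP. Qed.

HB.instance Definition _ s :=
  GRing.isLinear.Build rat 'rV[rat]_r 'rV[rat]_r _ (wact s) (wact_is_linear s).

(** The weights of the module constructed above, taken over [rat], include [lam] and are stable
    under simple reflections, so they contain its orbit. *)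
Lemma orbit_below_int lam s : dom (toQ lam) -> pos (toQ lam - wact s (toQ lam)).
Proof.
move=> dl; pose A i j := pairing (alpha j) (coroot D (alpha i)).
pose hw i := pairing lam (coroot D (alpha i)).
suff [c _ ->] : exists2 c, weight rat A hw c & wact s (toQ lam) = down alpha (toQ lam) c.
  by move=> i; rewrite (coef_down baseD).
elim: s => [|i s [c wc E]]; first by exists [ffun=> 0%N]; rewrite ?down0 //; apply: weight0.
by have [c' wc' E'] := weight_reflection_down baseD dl i wc; exists c'; rewrite //= E E'.
Qed.

Lemma orbit_below l s : dom l -> pos (l - wact s l).
Proof.
move=> dl; have [N N0 [lam E]] := rV_common_denominator l.
have Nr : 0 < (N%:R : rat) by rewrite ltr0n.
have := @orbit_below_int lam s; rewrite -E linearZ /= -scalerBr => h i.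
have := h _ i; rewrite coefZ pmulr_rge0 //; apply.
exact: domZ (ltW Nr) dl.
Qed.

Lemma weyl_polytope_reflection a l m : a \in roots D -> weyl_polytope D l m ->
  weyl_polytope D l (reflection D a m).
Proof.
move=> aD; apply: conv_hull_linear; first exact: reflection_is_linear.
by move=> y [w ww <-]; exists (reflection D a \o w) => //; apply: weyl_refl.
Qed.

Lemma weyl_polytopeZ t l m : weyl_polytope D l m -> weyl_polytope D (t *: l) (t *: m).
Proof.
apply: (conv_hull_linear (f := fun v => t *: v)).
  by move=> c x y; rewrite scalerDr !scalerA mulrC.
move=> y [w ww <-]; exists w => //.
have f0 : w 0 = 0.
  by have := weyl_group_linear ww (-1) 0 0; rewrite scaler0 addr0 scaleN1r addNr.
by have := weyl_group_linear ww t l 0; rewrite f0 !addr0.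
Qed.

(** The point [m - toQ a] lies on the segment from [m] to its reflection, at parameter the inverse
    of the pairing. *)
Lemma weyl_polytope_sub_root a l m : a \in roots D -> weyl_polytope D l m ->
  1 <= pairing m (coroot D a) -> weyl_polytope D l (m - toQ a).
Proof.
move=> aD Pm; set z := pairing _ _ => z1.
have zn0 : z != 0 by rewrite gt_eqF // (lt_le_trans ltr01).
have := conv_hull_convex (t := z^-1) Pm (weyl_polytope_reflection aD Pm).
rewrite /reflection -/z scalerBr scalerA mulVf // scale1r addrA -scalerDl subrK scale1r.
by apply; rewrite invr_ge0 (le_trans ler01) //= invf_le1 // (lt_le_trans ltr01).
Qed.

(** The descent applies because positive pairings of integral weights are at least 1. *)
Lemma down_in_weyl_polytope lam k : dom (down alpha (toQ lam) k) ->
  weyl_polytope D (toQ lam) (down alpha (toQ lam) k).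
Proof.
apply: (dominant_descent scD baseD
  (S := fun c => weyl_polytope D (toQ lam) (down alpha (toQ lam) c))).
  by rewrite down0; apply: conv_hull_subset; exists id => //; apply: weyl_id.
move=> c i Pc; rewrite down_incr pairing_down.
set z := wt_at _ _ i c => z0.
have z1 : 1 <= z%:~R :> rat by rewrite ler1z -gtz0_ge1 -(ltr0z rat).
have aD : alpha i \in roots D by case: baseD.
apply: weyl_polytope_sub_root => //.
by rewrite pairing_down.
Qed.

Lemma intersection_polytopeE l : dom l ->
  intersection_polytope D alpha l = [set m | below (l, m)].
Proof.
move=> dl; apply/seteqP; split=> m /=.
  move=> [[n [c [p [c0 c1 hp ->]]]] dm]; split=> //=.
  rewrite -[l in l - _]scale1r -c1 scaler_suml -sumrB.
  elim/big_rec: _ => [|i x _ hx]; first exact: pos0.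
  apply: posD => //; rewrite -scalerBr; apply: posZ => //.
  have [w ww <-] := hp i; have [s ->] := weyl_groupP baseD ww.
  exact: orbit_below.
move=> hlm; have [N N0 [lam [k [El Em]]]] := below_integral baseD hlm.
have [_ /= dm _] := hlm; split=> //.
have Nr : (N%:R : rat) != 0 by rewrite pnatr_eq0 -lt0n.
rewrite -[l]scale1r -[m]scale1r -(mulVf Nr) -!scalerA; apply: weyl_polytopeZ.
rewrite El Em; apply: down_in_weyl_polytope; rewrite -Em.
by apply: domZ => //; apply: ler0n.
Qed.

End IntersectionPolytope.

(** * Extremal rays *)

Lemma perturbation_size (I : finType) (a b : I -> rat) :
    (forall i, 0 <= a i) -> (forall i, a i = 0 -> b i = 0) ->
  exists2 eps, 0 < eps & forall i, `|eps * b i| <= a i.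
Proof.
(* Terms with [a i = 0] contribute 0 by the convention on division; the leading 1 keeps [S]
   positive. *)
move=> a0 ab; pose S := 1 + \sum_i `|b i| / a i.
have T0 i : 0 <= `|b i| / a i by rewrite divr_ge0.
have S0 : 0 < S by rewrite ltr_pwDl // sumr_ge0.
exists S^-1; rewrite ?invr_gt0 // => i.
have := a0 i; rewrite le_eqVlt => /orP [/eqP ai|ai].
  by rewrite ab // mulr0 normr0.
rewrite normrM gtr0_norm ?invr_gt0 // ler_pdivrMl // -ler_pdivrMr //.
rewrite /S (bigD1 i) //= addrA [1 + _]addrC -addrA lerDl addr_ge0 //.
exact: sumr_ge0.
Qed.

Section ExtremalRays.
Variables (r : nat) (D : root_datum r).
Hypothesis scD : simply_connected D.
Variable alpha : 'I_r -> 'rV[int]_r.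
Hypothesis baseD : is_base D alpha.
Variable varpi : 'I_r -> 'rV[rat]_r.
Hypothesis varpiE : fundamental_weights D alpha varpi.
Implicit Types (x y v l m : 'rV[rat]_r) (i j : 'I_r).

Local Notation al i := (toQ (alpha i)).
Local Notation pr v i := (pairing v (coroot D (alpha i))).
Local Notation coef := (coef alpha).
Local Notation pos := (pos alpha).
Local Notation below := (below D alpha).

(** Here [- m] is a nonnegative combination of simple roots that is obtuse to all of them. *)
Lemma below0 m : below (0, m) -> m = 0.
Proof.
move=> [/= _ dm pm]; apply: oppr_inj; rewrite oppr0; rewrite sub0r in pm.
apply: (pos_obtuse_eq0 scD baseD pm) => i _.
by rewrite -sub0r pairingB pairing0 sub0r oppr_le0.
Qed.

Lemma pairing_coef x i : pr x i = \sum_k coef x k * pr (al k) i.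
Proof.
by rewrite {1}[x](coefE baseD) pairing_sum; apply: eq_bigr => k _; rewrite pairingZ.
Qed.

(* Principal submatrices of the Cartan matrix are invertible. *)
Lemma principal_cartan_solve (E : pred 'I_r) (y : 'I_r -> rat) :
  exists b, (forall i, ~~ E i -> coef b i = 0) /\ (forall i, E i -> pr b i = y i).
Proof.
(* The block of the Cartan matrix on [E], completed by the identity to keep size [r]. *)
pose X := \matrix_(k, i) if E k && E i then pr (al k) i else (k == i)%:R.
have Xout (d : 'rV_r) i : ~~ E i -> (d *m X) 0 i = d 0 i.
  move=> Ei; rewrite mxE (bigD1 i) //= mxE (negPf Ei) andbF eqxx mulr1 big1 ?addr0 // => k.
  by move=> /negPf ki; rewrite mxE (negPf Ei) andbF ki mulr0.
have Xin (d : 'rV_r) i : (forall k, ~~ E k -> d 0 k = 0) -> E i ->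
    (d *m X) 0 i = pr (\sum_k d 0 k *: al k) i.
  move=> dE Ei; rewrite mxE pairing_sum; apply: eq_bigr => k _.
  rewrite mxE Ei andbT pairingZ; case: ifPn => // /dE ->.
  by rewrite !mul0r.
(* A kernel vector [d] vanishes off [E], and the combination [b] is orthogonal to the simple roots
   in [E]; hence [b] has norm zero. *)
have Xu : X \in unitmx.
  rewrite -row_free_unit; apply: inj_row_free => d dX.
  have dE k : ~~ E k -> d 0 k = 0 by move=> /(Xout d) <-; rewrite dX mxE.
  pose b := \sum_k d 0 k *: al k.
  have b0 : b = 0.
    apply: (wform_eq0 scD); rewrite {1}(wform_coef baseD) big1 // => i _.
    rewrite (coef_sum baseD) (wform_simple baseD).
    have [Ei|/dE ->] := boolP (E i); last by rewrite mul0r.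
    by rewrite -(Xin d i dE Ei) dX mxE mul0r mulr0.
  by apply/rowP => k; rewrite -(coef_sum baseD (d 0) k) -/b b0 mxE coef0.
pose y' := \row_i (if E i then y i else 0).
pose d := y' *m invmx X; have dX : d *m X = y' by rewrite mulmxKV.
have dE k : ~~ E k -> d 0 k = 0.
  by move=> Ek; rewrite -(Xout d k Ek) dX mxE (negPf Ek).
exists (\sum_k d 0 k *: al k); split=> i Ei; first by rewrite (coef_sum baseD) dE.
by rewrite -(Xin d i dE Ei) dX mxE Ei.
Qed.

(* The wall conditions [pr m i = 0] and [coef (l - m) i = 0] met by [(l, m)]
   survive along [(varpi j, varpi j - b)]: [b] is supported where
   [coef (l - m)] is nonzero, and it solves the remaining ones.  If both
   conditions hold at [i], then [pr l i = 0] and all neighbours [k] of [i] in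
   the Dynkin diagram satisfy [coef (l - m) k = 0]. *)
Lemma below_perturbation l m j : below (l, m) -> 0 < pr l j ->
  exists d eps, [/\ 0 < eps, below ((l, m) + eps *: (varpi j, d)) &
                    below ((l, m) - eps *: (varpi j, d))].
Proof.
move=> [/= dl dm plm] lj.
have [b [b0 bE]] := principal_cartan_solve
  (fun i => (pr m i == 0) && (coef (l - m) i != 0)) (fun i => (j == i)%:R).
have wall i : pr m i = 0 -> pr (varpi j - b) i = 0.
  move=> mi; rewrite pairingB varpiE.
  have [ci|ci] := eqVneq (coef (l - m) i) 0; last by rewrite bE ?mi ?eqxx ?ci // subrr.
  have li : pr l i = \sum_k coef (l - m) k * pr (al k) i.
    by rewrite -pairing_coef pairingB mi subr0.
  have t0 k : coef (l - m) k * pr (al k) i <= 0.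
    have [->|ki] := eqVneq k i; first by rewrite ci mul0r.
    by rewrite mulr_ge0_le0 // pairing_toQ lerz0 (cartan_le0 baseD) // eq_sym.
  have li0 : pr l i = 0.
    by apply/eqP; rewrite eq_le dl andbT li sumr_le0.
  have tk k : coef (l - m) k * pr (al k) i = 0.
    have /eqP : \sum_k - (coef (l - m) k * pr (al k) i) = 0 by rewrite sumrN -li li0 oppr0.
    rewrite psumr_eq0 => [/allP /(_ k)|n _]; last by rewrite oppr_ge0.
    by rewrite mem_index_enum oppr_eq0 => /(_ isT) /eqP.
  have -> : (j == i) = false.
    by apply/negP => /eqP E; rewrite E li0 ltxx in lj.
  rewrite pairing_coef big1 ?subrr // => k _.
  have [/b0 ->|] := boolP (~~ ((pr m k == 0) && (coef (l - m) k != 0))); first by rewrite mul0r.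
  rewrite negbK => /andP [_ ck]; have /eqP := tk k.
  by rewrite mulf_eq0 (negPf ck) /= => /eqP ->; rewrite mulr0.
(* All [3 r] inequalities are gathered into one family: [a] holds their values at [(l, m)] and [e]
   their variations along [(varpi j, varpi j - b)]. *)
pose a (z : 'I_r + ('I_r + 'I_r)) := match z with
  inl i => pr l i | inr (inl i) => pr m i | inr (inr i) => coef (l - m) i end.
pose e (z : 'I_r + ('I_r + 'I_r)) := match z with
  inl i => pr (varpi j) i | inr (inl i) => pr (varpi j - b) i | inr (inr i) => coef b i end.
have [] := @perturbation_size _ a e.
- by case=> [|[|]].
- case=> [i|[i|i]] /= h; last by rewrite b0 ?h ?eqxx ?andbF.
    rewrite varpiE; case: eqP => // E.
    by rewrite E h ltxx in lj.
  exact: wall.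
move=> eps e0 h; exists (varpi j - b), eps.
have S (u v : rat) : `|v| <= u -> 0 <= u + v /\ 0 <= u - v by rewrite ler_norml; lra.
have lin := (pairingB, pairingD, coefN, coefD, pairingZ, coefZ).
split=> //; split=> i; rewrite /= !lin.
- by have := (S _ _ (h (inl i))).1.
- by have := (S _ _ (h (inr (inl i)))).1; rewrite /= !lin.
- by have := (S _ _ (h (inr (inr i)))).1; rewrite /= !lin => H; lra.
- by have := (S _ _ (h (inl i))).2.
- by have := (S _ _ (h (inr (inl i)))).2; rewrite /= !lin.
by have := (S _ _ (h (inr (inr i)))).2; rewrite /= !lin => H; lra.
Qed.

End ExtremalRays.

Lemma ray_self (V : lmodType rat) (v : V) : ray v v.
Proof. by exists 1; rewrite ?scale1r //=. Qed.

Lemma rayZ (V : lmodType rat) (v : V) t : 0 < t -> ray (t *: v) = ray v.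
Proof.
move=> t0; apply/seteqP; split=> _ [s /= s0 <-].
  by exists (s * t); rewrite ?scalerA //= mulr_ge0 // ltW.
exists (s / t); first by rewrite /= divr_ge0 // ltW.
by rewrite scalerA divfK // gt_eqF.
Qed.

(** * Vertices and extremal rays *)

Section Main.
Variables (r : nat) (D : root_datum r).
Hypothesis scD : simply_connected D.
Variable alpha : 'I_r -> 'rV[int]_r.
Hypothesis baseD : is_base D alpha.
Variable varpi : 'I_r -> 'rV[rat]_r.
Hypothesis varpiE : fundamental_weights D alpha varpi.
Implicit Types (x y v l m : 'rV[rat]_r) (i j : 'I_r).

Local Notation pr v i := (pairing v (coroot D (alpha i))).
Local Notation dom := (dominant_cone D alpha).
Local Notation below := (below D alpha).
Local Notation IP := (intersection_polytope D alpha).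

Lemma varpi_dominant j : dom (varpi j).
Proof. by move=> i; rewrite varpiE ler0n. Qed.

Lemma below_IP j m : below (varpi j, m) <-> IP (varpi j) m.
Proof. by rewrite (intersection_polytopeE scD baseD (varpi_dominant j)). Qed.

Lemma scale_varpi_inj j s t : s *: varpi j = t *: varpi j -> s = t.
Proof. by move=> /(congr1 (fun v => pr v j)); rewrite !pairingZ varpiE eqxx !mulr1. Qed.

(** Away from [j] the nonnegative pairings of [l] and [l'] add up to zero. *)
Lemma dominant_summand l l' j t : dom l -> dom l' -> l + l' = t *: varpi j ->
  l = pr l j *: varpi j.
Proof.
move=> dl dl' E; apply/subr0_eq/(pairing_simple_inj scD baseD) => i.
rewrite pairingB pairingZ varpiE; case: eqP => [->|/eqP ji]; first by rewrite mulr1 subrr.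
rewrite mulr0 subr0; apply/eqP; rewrite eq_le dl andbT.
have : pr l i + pr l' i = 0.
  by rewrite -pairingD E pairingZ varpiE (negPf ji) mulr0.
by have := dl' i; lra.
Qed.

(** After rescaling, [m] and [m'] become points of the polytope with [mu] as a proper convex
    combination. If [s] or [s'] is zero, [below0] replaces the rescaling. *)
Lemma vertex_summand j mu s s' m m' : vertex (IP (varpi j)) mu -> 0 <= s -> 0 <= s' ->
  below (s *: varpi j, m) -> below (s' *: varpi j, m') -> m + m' = (s + s') *: mu ->
  m = s *: mu.
Proof.
move=> [_ vx] s0 s0' b b' E.
have [z|sn0] := eqVneq s 0.
  by rewrite z scale0r; apply: (below0 scD baseD (m := m)); rewrite z scale0r in b.
have [z|sn0'] := eqVneq s' 0.
  rewrite z scale0r in b'; have m0 := below0 scD baseD b'.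
  by rewrite m0 z !addr0 in E.
have sp : 0 < s by rewrite lt0r sn0.
have sp' : 0 < s' by rewrite lt0r sn0'.
have ssp : 0 < s + s' by rewrite addr_gt0.
have IPs t x : 0 < t -> below (t *: varpi j, x) -> IP (varpi j) (t^-1 *: x).
  move=> t0 bx; apply/below_IP; rewrite -[varpi j](scalerK (a := t)); last first.
    by rewrite gt_eqF.
  by apply: (belowZ (p := (t *: varpi j, x))); rewrite ?invr_ge0 ?ltW.
have [] := vx _ _ (s / (s + s')) (IPs _ _ sp b) (IPs _ _ sp' b').
- by rewrite divr_gt0 //= ltr_pdivrMr // mul1r ltrDl.
- have -> : 1 - s / (s + s') = s' / (s + s') by field; rewrite gt_eqF.
  rewrite !scalerA ![_ / (s + s')]mulrC -!mulrA !mulfV // !mulr1 -scalerDr E.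
  by rewrite scalerA mulVf ?scale1r // gt_eqF.
by move=> <- _; rewrite scalerA mulfV // scale1r.
Qed.

Lemma vertex_extremal_ray j mu : vertex (IP (varpi j)) mu ->
  extremal_ray [set p | below p] (ray (varpi j, mu)).
Proof.
move=> vx; split.
- exists (varpi j, mu) => //; apply/eqP => -[v0 _].
  by have := varpiE j j; rewrite v0 pairing0 eqxx => /esym /eqP; rewrite oner_eq0.
- by move=> _ [t /= t0 <-]; apply: belowZ => //; apply/below_IP; case: vx.
move=> [l m] [l' m'] /= b b' [t /= t0 [El Em]].
have [/= dl _ _] := b; have [/= dl' _ _] := b'.
have lE := dominant_summand dl dl' (esym El).
have lE' : l' = pr l' j *: varpi j.
  by apply: (dominant_summand dl' dl (t := t)); rewrite addrC.
have tE : t = pr l j + pr l' j.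
  by apply: (@scale_varpi_inj j); rewrite El scalerDl -lE -lE'.
rewrite lE in b; rewrite lE' in b'; rewrite tE in Em.
split; [exists (pr l j)|exists (pr l' j)]; rewrite /= ?dl ?dl' //;
  apply: injective_projections => //=.
  by rewrite (vertex_summand vx (dl j) (dl' j) b b').
by rewrite (vertex_summand vx (dl' j) (dl j) b' b) // addrC -Em addrC.
Qed.

(** The two perturbations of [(l, m)] sum to twice it, so they lie on the ray, which makes [l]
    proportional to [varpi j]. A convex decomposition of [mu] then decomposes a point of the ray. *)
Lemma extremal_ray_vertex L : extremal_ray [set p | below p] L ->
  exists j mu, vertex (IP (varpi j)) mu /\ L = ray (varpi j, mu).
Proof.
move=> [[[l m] p0 LE] LK Lx].
have bp : below (l, m) by apply: LK; rewrite LE; apply: ray_self.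
have [dl _ _] := bp; rewrite /= in dl.
have [j lj] : exists j, 0 < pr l j.
  apply: contrapT => h; case/eqP: p0.
  have l0 : l = 0.
    apply: (pairing_simple_inj scD baseD) => i; apply/eqP; rewrite eq_le dl andbT leNgt.
    by apply/negP => li; apply: h; exists i.
  by rewrite l0 in bp *; rewrite (below0 scD baseD bp).
have [d [eps [eps0 b1 b2]]] := below_perturbation scD baseD varpiE bp lj.
have [] := Lx _ _ b1 b2.
  rewrite LE; exists 2 => //.
  by rewrite [in RHS]addrACA subrr addr0 scaler_nat mulr2n.
(* The first components give [t *: l = l + eps *: varpi j]; pairing with the j-th coroot shows
   [t > 1]. *)
rewrite LE => -[t t0 /(congr1 fst) /= tE] _.
have t1 : 0 < t - 1.
  have := congr1 (fun v => pr v j) tE; rewrite pairingZ pairingD pairingZ varpiE eqxx mulr1.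
  move=> E; have : 0 < (t - 1) * pr l j by rewrite mulrBl E mul1r; lra.
  by rewrite pmulr_lgt0.
pose s := eps / (t - 1); have s0 : 0 < s by rewrite divr_gt0.
have ls : l = s *: varpi j.
  have E : (t - 1) *: l = eps *: varpi j by rewrite scalerBl scale1r tE addrC addKr.
  rewrite /s mulrC -[RHS]scalerA; apply: (canRL (scalerK _)) E.
  by rewrite gt_eqF.
pose mu := s^-1 *: m.
have pE : (l, m) = s *: (varpi j, mu).
  by apply: injective_projections => //=; rewrite /mu scalerA mulfV ?scale1r // gt_eqF.
have LE' : L = ray (varpi j, mu) by rewrite LE pE rayZ.
exists j, mu; split; last by rewrite -LE.
split.
  by apply/below_IP/LK; rewrite LE'; apply: ray_self.
move=> y z u /below_IP by_ /below_IP bz /andP [u0 u1] E.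
have u1' : 0 < 1 - u by rewrite subr_gt0.
have [] := Lx (u *: (varpi j, y)) ((1 - u) *: (varpi j, z)).
- exact: belowZ (ltW u0) by_.
- exact: belowZ (ltW u1') bz.
- rewrite LE' (_ : _ + _ = (varpi j, mu)); first exact: ray_self.
  by apply: injective_projections; rewrite /= ?E // -scalerDl addrC subrK scale1r.
(* The common first component [varpi j] fixes the scalar, so the second components agree. *)
have ext c x : 0 < c -> ray (varpi j, mu) (c *: (varpi j, x)) -> x = mu.
  move=> c0 [a _ Ea]; have := congr1 fst Ea; have := congr1 snd Ea.
  move=> /= E1 /scale_varpi_inj E2; rewrite E2 in E1.
  have cu : c != 0 by rewrite gt_eqF.
  by rewrite -[x](scalerK cu) -E1 scalerK.
by rewrite LE' => /(ext _ _ u0) -> /(ext _ _ u1') ->.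
Qed.

End Main.

Theorem theorem1p1 (R : realType) (r : nat) (D : root_datum r)
    (irrD : irreducible_datum D) (scD : simply_connected D)
    (alpha : 'I_r -> 'rV[int]_r) (baseD : is_base D alpha)
    (varpi : 'I_r -> 'rV[rat]_r)
    (varpiE : fundamental_weights D alpha varpi) :
  (forall L : set ('rV[rat]_r * 'rV[rat]_r)%type,
     extremal_ray (kostka_cone R[i] D alpha) L ->
     exists (j : 'I_r) (mu : 'rV[rat]_r),
       vertex (intersection_polytope D alpha (varpi j)) mu /\
       L = ray (varpi j, mu)) /\
  (forall (j : 'I_r) (mu : 'rV[rat]_r),
     vertex (intersection_polytope D alpha (varpi j)) mu ->
     extremal_ray (kostka_cone R[i] D alpha) (ray (varpi j, mu))).
Proof.
rewrite (kostka_coneE R[i] scD baseD varpiE); split.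
  by move=> L; apply: extremal_ray_vertex.
by move=> j mu; apply: vertex_extremal_ray.
Qed.
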